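(* Consider the trilinear form $$\mathcal{U}'_{res}\times\mathring{\mathcal{W}}^*_{res}\times\mathcal{U}_{res}\to\mathbb{C},\qquad(g,F,f)\mapsto\frac{i}{8\pi^2}\int_{\widetilde\Gamma}g(Z)\cdot F(Z)\cdot f(Z)\,dZ^3.$$ Its restrictions to $$\mathcal{U}'^+_{res}\times\mathbb{C}\text{-span}\{N(Z)^{k+\frac12}\,{}^*\mathbf{M}^m_l(Z),\ {}^*\mathbf{C}^m_{k,l}(Z):\ k\ge-(l+1)\}\times\mathcal{U}^+_{res}$$ and to $$\mathcal{U}'^-_{res}\times\mathbb{C}\text{-span}\{N(Z)^{k-\frac12}\,{}^*\mathbf{M}^m_l(Z),\ {}^*\mathbf{C}^m_{k,l}(Z):\ k\le-1\}\times\mathcal{U}^-_{res}$$ are identically zero. (Here $k\in\mathbb{Z}$ and $l,m$ run over all admissible values.)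
   Context: Let $Z=\begin{pmatrix} z_{11} & z_{12} \\ z_{12} & z_{22} \end{pmatrix}$ denote a complex symmetric $2\times2$ matrix, $z_{12}=it$; use coordinates $z_{11},z_{22},t$; $N(Z)=\det Z=z_{11}z_{22}+t^2$. $P=\mathbb{C}[z_{11},z_{12},z_{22},N(Z)^{-1}]$ and $N(Z)^{1/2}P$ is the corresponding space with half-integer powers of $N(Z)$. $\mathrm{Sym}$: complex symmetric $2\times2$ matrices; $\mathbb{S}=\mathbb{C}^2$ (columns), $\mathbb{S}'=\mathbb{C}^2$ (rows). $\mathcal{U}_{res}=\mathbb{S}\otimes P$, $\mathcal{U}^+_{res}=\mathbb{S}\otimes\mathbb{C}[z_{11},z_{12},z_{22}]$, $\mathcal{U}^-_{res}=\{f\in\mathcal{U}_{res}:N(Z)^{-1}Zf(Z^{-1})\in\mathcal{U}^+_{res}\}$; $\mathcal{U}'_{res}=\mathbb{S}'\otimes P$, $\mathcal{U}'^+_{res}=\mathbb{S}'\otimes\mathbb{C}[z_{11},z_{12},z_{22}]$, $\mathcal{U}'^-_{res}=\{g\in\mathcal{U}'_{res}:N(Z)^{-1}g(Z^{-1})Z\in\mathcal{U}'^+_{res}\}$. $\mathring{\mathcal{W}}^*_{res}=\mathrm{Sym}\otimes N(Z)^{1/2}P$. Solid harmonics: $P^m_l(x)=\frac{(-1)^m}{2^ll!}(1-x^2)^{m/2}\frac{d^{l+m}}{dx^{l+m}}(x^2-1)^l$; for $l\ge0$, $|m|\le l$, $R^m_l(Z)$ is the homogeneous polynomial of degree $l$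 in $z_{11},z_{22},t$ that for $z_{11}=z$, $z_{22}=\bar z$, $t\in\mathbb{R}$, $r=\sqrt{|z|^2+t^2}$ equals $r^l(z/|z|)^mP^m_l(t/r)$; $R^m_l=0$ if $|m|>l$. Put ${}^*\mathbf{T}^m_l=\begin{pmatrix} (l+m)(l+m+1)R^{m-1}_l & i(l+m+1)R^m_l \\ i(l+m+1)R^m_l & -R^{m+1}_l \end{pmatrix}$ ($l\ge 0$, $-l-1\le m\le l+1$), ${}^*\mathbf{M}^m_l=\begin{pmatrix} (l+m)(l-m+1)R^{m-1}_l & -i m R^m_l \\ -i m R^m_l & R^{m+1}_l \end{pmatrix}$ ($l\ge0$, $-l\le m\le l$), ${}^*\mathbf{B}^m_l=\begin{pmatrix} (l-m)(l-m+1)R^{m-1}_l & -i(l-m)R^m_l \\ -i(l-m)R^m_l & -R^{m+1}_l \end{pmatrix}$ ($l\ge1$, $-l+1\le m\le l-1$), ${}^*\mathbf{C}^m_{k,l}=(2k+1)l\,N(Z)^{k-\frac12}\,{}^*\mathbf{B}^m_{l+1}+2(k+l+1)(l+1)N(Z)^{k+\frac12}\,{}^*\mathbf{T}^m_{l-1}$ ($k\in\mathbb{Z}$, $l\ge1$, $-l\le m\le l$). $\widetilde\Gamma=S^2\times S^1$, where $S^2=\{X=\begin{pmatrix} z & it \\ it & \bar z \end{pmatrix}:z\in\mathbb{C},t\in\mathbb{R},\det X=1\}$ and $S^1=\{\zeta\in\mathbb{C}:|\zeta|=1\}$; functions are pulled back to $\widetilde\Gamma$ via $(X,\zeta)\mapsto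 Z=\zeta X$, with $N(Z)^{1/2}=\zeta$. $dZ^3=dz^0\wedge dz^1\wedge dz^3$, where $z_{11}=z^0-iz^3$, $z_{22}=z^0+iz^3$, $z_{12}=-iz^1$. $\widetilde\Gamma$ is oriented so that at $(1,1)$ the tangent vectors $\frac{1}{i}\begin{pmatrix} 1 & 0 \\ 0 & 1 \end{pmatrix}$, $\begin{pmatrix} 0 & -i \\ -i & 0 \end{pmatrix}$, $\begin{pmatrix} -i & 0 \\ 0 & i \end{pmatrix}$ (in this order) form a positive basis. *)

(* Defs.v *)
From HB Require Import structures.
From mathcomp Require Import all_boot all_order all_algebra.
From mathcomp Require Import all_classical all_reals all_analysis.
From mathcomp Require Import complex ring lra zify.
(* The notations of mpoly clash with those of MathComp-Analysis. *)
From mathcomp Require Import -(notations) mpoly.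

Set Implicit Arguments.
Unset Strict Implicit.
Unset Printing Implicit Defensive.

Import Order.TTheory GRing.Theory Num.Theory.
Import numFieldNormedType.Exports.
Local Open Scope classical_set_scope.
Local Open Scope ring_scope.
Local Open Scope complex_scope.

Definition mx2 (K : Type) (a b c d : K) : 'M[K]_2 :=
  \matrix_(i, j) if i == 0 then (if j == 0 then a else b)
                 else (if j == 0 then c else d).

(* A polynomial in z_11, z_22, t is evaluated at a symmetric matrix Z through
   z_12 = i t, that is t = - i z_12; C[z_11, z_12, z_22] = C[z_11, z_22, t]. *)
Definition coords (R : realType) (Z : 'M[R[i]]_2) : 'I_3 -> R[i] :=
  tnth [tuple Z 0 0; Z 1 1; - 'i * Z 0 1].

Definition peval (R : realType) (p : mpoly 3 R[i]) (Z : 'M[R[i]]_2) : R[i] :=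
  meval (coords Z) p.

(* Elements of C[z_11, z_12, z_22] and of P are functions of Z; as the matrix
   type also contains nonsymmetric and singular matrices, only the values on
   the common domain of definition are constrained. *)
Definition sym_inv (R : realType) (Z : 'M[R[i]]_2) : Prop :=
  Z^T = Z /\ \det Z != 0.

Definition is_poly (R : realType) (h : 'M[R[i]]_2 -> R[i]) : Prop :=
  exists p : mpoly 3 R[i], forall Z, sym_inv Z -> h Z = peval p Z.

Definition is_P (R : realType) (h : 'M[R[i]]_2 -> R[i]) : Prop :=
  exists (p : mpoly 3 R[i]) (n : nat),
    forall Z, sym_inv Z -> h Z = peval p Z / \det Z ^+ n.

Definition Ures (R : realType) : set ('M[R[i]]_2 -> 'cV[R[i]]_2) :=
  [set f | forall j, is_P (fun Z => f Z j 0)].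

Definition Ures_plus (R : realType) : set ('M[R[i]]_2 -> 'cV[R[i]]_2) :=
  [set f | forall j, is_poly (fun Z => f Z j 0)].

Definition Ures_minus (R : realType) : set ('M[R[i]]_2 -> 'cV[R[i]]_2) :=
  [set f | Ures f /\ Ures_plus (fun Z => (\det Z)^-1 *: (Z *m f (invmx Z)))].

Definition U'res (R : realType) : set ('M[R[i]]_2 -> 'rV[R[i]]_2) :=
  [set g | forall j, is_P (fun Z => g Z 0 j)].

Definition U'res_plus (R : realType) : set ('M[R[i]]_2 -> 'rV[R[i]]_2) :=
  [set g | forall j, is_poly (fun Z => g Z 0 j)].

Definition U'res_minus (R : realType) : set ('M[R[i]]_2 -> 'rV[R[i]]_2) :=
  [set g | U'res g /\ U'res_plus (fun Z => (\det Z)^-1 *: (g (invmx Z) *m Z))].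

(* Functions with half-integer powers of N(Z) live on the double cover
   {(Z, s) : s ^ 2 = N(Z)} of the invertible symmetric matrices, on which
   N(Z)^(n/2) is s ^ n. *)
Definition on_cover (R : realType) (Z : 'M[R[i]]_2) (s : R[i]) : Prop :=
  sym_inv Z /\ s ^+ 2 = \det Z.

Definition Wres (R : realType) : set ('M[R[i]]_2 -> R[i] -> 'M[R[i]]_2) :=
  [set F | (forall Z s, on_cover Z s -> (F Z s)^T = F Z s) /\
     forall j k, exists2 h, is_P h &
       forall Z s, on_cover Z s -> F Z s j k = s * h Z].

Definition Cspan (R : realType)
    (S : set ('M[R[i]]_2 -> R[i] -> 'M[R[i]]_2)) :
    set ('M[R[i]]_2 -> R[i] -> 'M[R[i]]_2) :=
  [set F | exists (n : nat) (c : 'I_n -> R[i])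
             (G : 'I_n -> 'M[R[i]]_2 -> R[i] -> 'M[R[i]]_2),
     (forall j, S (G j)) /\
     forall Z s, on_cover Z s -> F Z s = \sum_j c j *: G j Z s].

(* Used for l + m >= 0 only, where the order of differentiation is |l + m|. *)
Definition legendre (R : realType) (l : nat) (m : int) (x : R) : R :=
  (-1) ^ m / (2 ^+ l * l`!%:R) * (1 - x ^+ 2) `^ (m%:~R / 2)
  * ((('X ^+ 2 - 1) ^+ l : {poly R})^`(absz (l%:Z + m))).[x].

(* The point z = 0, where z / |z| is undefined, is left out: such points are
   in the closure of the others. *)
Definition is_solid_harmonic (R : realType) (l : nat) (m : int)
    (p : mpoly 3 R[i]) : Prop :=
  p \is ishomog1 l mdeg /\
  forall (z : R[i]) (t : R), z != 0 ->
    let r := Num.sqrt (complex.Re z ^+ 2 + complex.Im z ^+ 2 + t ^+ 2) in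
    meval (tnth [tuple z; z^*; t%:C]) p =
      (r ^+ l)%:C * (z / `|z|) ^ m * (legendre l m (t / r))%:C.

Definition solid_harmonic (R : realType) (l : nat) (m : int) : mpoly 3 R[i] :=
  if (`|m| <= l)%N then xget 0 [set p | is_solid_harmonic l m p] else 0.

Definition RR (R : realType) (l : nat) (m : int) (Z : 'M[R[i]]_2) : R[i] :=
  peval (solid_harmonic R l m) Z.

Definition starT (R : realType) (l : nat) (m : int) (Z : 'M[R[i]]_2) :
    'M[R[i]]_2 :=
  let a := 'i * (l%:Z + m + 1)%:~R * RR l m Z in
  mx2 (((l%:Z + m) * (l%:Z + m + 1))%:~R * RR l (m - 1) Z) a
      a (- RR l (m + 1) Z).

Definition starM (R : realType) (l : nat) (m : int) (Z : 'M[R[i]]_2) :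
    'M[R[i]]_2 :=
  let a := - 'i * m%:~R * RR l m Z in
  mx2 (((l%:Z + m) * (l%:Z - m + 1))%:~R * RR l (m - 1) Z) a
      a (RR l (m + 1) Z).

Definition starB (R : realType) (l : nat) (m : int) (Z : 'M[R[i]]_2) :
    'M[R[i]]_2 :=
  let a := - 'i * (l%:Z - m)%:~R * RR l m Z in
  mx2 (((l%:Z - m) * (l%:Z - m + 1))%:~R * RR l (m - 1) Z) a
      a (- RR l (m + 1) Z).

(* N(Z)^(k + e/2) *M^m_l, for e odd *)
Definition NstarM (R : realType) (k e : int) (l : nat) (m : int)
    (Z : 'M[R[i]]_2) (s : R[i]) : 'M[R[i]]_2 :=
  s ^ (2 * k + e) *: starM l m Z.

(* Meaningful for l >= 1. *)
Definition starC (R : realType) (k : int) (l : nat) (m : int)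
    (Z : 'M[R[i]]_2) (s : R[i]) : 'M[R[i]]_2 :=
  (((2 * k + 1) * l%:Z)%:~R * s ^ (2 * k - 1)) *: starB l.+1 m Z
  + ((2 * (k + l%:Z + 1) * (l%:Z + 1))%:~R * s ^ (2 * k + 1))
      *: starT l.-1 m Z.

Definition Wgens_plus (R : realType) :
    set ('M[R[i]]_2 -> R[i] -> 'M[R[i]]_2) :=
  [set G | exists (k : int) (l : nat) (m : int),
     [/\ (`|m| <= l)%N, - (l%:Z + 1) <= k &
         G = NstarM k 1 l m \/ ((1 <= l)%N /\ G = starC k l m)]].

Definition Wgens_minus (R : realType) :
    set ('M[R[i]]_2 -> R[i] -> 'M[R[i]]_2) :=
  [set G | exists (k : int) (l : nat) (m : int),
     [/\ (`|m| <= l)%N, k <= -1 &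
         G = NstarM k (-1) l m \/ ((1 <= l)%N /\ G = starC k l m)]].

Definition expi (R : realType) (a : R) : R[i] := cos a +i* sin a.

(* z = sin theta e^(i phi), t = cos theta, so that |z|^2 + t^2 = 1 *)
Definition sphere_pt (R : realType) (theta phi : R) : 'M[R[i]]_2 :=
  let z := (sin theta)%:C * expi phi in
  let t := (cos theta)%:C in
  mx2 z ('i * t) ('i * t) z^*.

Definition Gam (R : realType) (a theta phi : R) : 'M[R[i]]_2 :=
  expi a *: sphere_pt theta phi.

Definition cderive (R : realType) (h : R -> R[i]) (x : R) : R[i] :=
  derive1 (fun y => complex.Re (h y)) x
  +i* derive1 (fun y => complex.Im (h y)) x.

Definition mxderive (R : realType) (h : R -> 'M[R[i]]_2) (x : R) :
    'M[R[i]]_2 :=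
  \matrix_(j, k) cderive (fun y => h y j k) x.

(* (z^0, z^1, z^3), where z_11 = z^0 - i z^3, z_22 = z^0 + i z^3,
   z_12 = - i z^1 *)
Definition zcoord (R : realType) (Z : 'M[R[i]]_2) : 'I_3 -> R[i] :=
  tnth [tuple (Z 0 0 + Z 1 1) / 2; 'i * Z 0 1; (Z 1 1 - Z 0 0) / (2 * 'i)].

(* dz^0 /\ dz^1 /\ dz^3 evaluated on three tangent vectors *)
Definition dZ3 (R : realType) (v : 'I_3 -> 'M[R[i]]_2) : R[i] :=
  \det (\matrix_(j < 3, k < 3) zcoord (v k) j).

Definition Gam_frame (R : realType) (a theta phi : R) : 'I_3 -> 'M[R[i]]_2 :=
  tnth [tuple mxderive (fun x => Gam x theta phi) a;
              mxderive (fun x => Gam a x phi) theta;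
              mxderive (fun x => Gam a theta x) phi].

Definition cintegral (R : realType) (a b : R) (h : R -> R[i]) : R[i] :=
  Rintegral (@lebesgue_measure R) `[a, b] (fun x => complex.Re (h x))
  +i* Rintegral (@lebesgue_measure R) `[a, b] (fun x => complex.Im (h x)).

(* Integral over S^2 x S^1 of h(Z, N(Z)^(1/2)) dZ^3, the form being pulled back
   by (a, theta, phi) |-> (sphere_pt theta phi, e^(i a)), which parametrizes
   S^2 x S^1 up to a null set and is positively oriented, see
   Gam_frame_base. *)
Definition Gam_integral (R : realType) (h : 'M[R[i]]_2 -> R[i] -> R[i]) :
    R[i] :=
  cintegral 0 (2 * pi) (fun a =>
    cintegral 0 pi (fun theta =>
      cintegral 0 (2 * pi) (fun phi =>
        h (Gam a theta phi) (expi a) * dZ3 (Gam_frame a theta phi)))).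

Definition trilinear (R : realType) (g : 'M[R[i]]_2 -> 'rV[R[i]]_2)
    (F : 'M[R[i]]_2 -> R[i] -> 'M[R[i]]_2) (f : 'M[R[i]]_2 -> 'cV[R[i]]_2) :
    R[i] :=
  'i / (8 * (pi : R) ^+ 2)%:C
  * Gam_integral (fun Z s => (g Z *m F Z s *m f Z) 0 0).

Definition parity_poly (R : realType) (d : nat) (p : {poly R}) : Prop :=
  forall j, p`_j != 0 -> (j <= d)%N /\ odd j = odd d.

Lemma parity_polyD (R : realType) d (p q : {poly R}) :
  parity_poly d p -> parity_poly d q -> parity_poly d (p + q).
Proof.
move=> hp hq j; rewrite coefD => nz.
have [p0|/hp//] := eqVneq p`_j 0; apply: hq.
by move: nz; rewrite p0 add0r.
Qed.

Lemma parity_polyMn (R : realType) d (p : {poly R}) n :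
  parity_poly d p -> parity_poly d (p *+ n).
Proof.
move=> hp j; rewrite coefMn => nz; apply: hp.
by apply: contraNneq nz => ->; rewrite mul0rn.
Qed.

Lemma parity_polyM (R : realType) d e (p q : {poly R}) :
  parity_poly d p -> parity_poly e q -> parity_poly (d + e) (p * q).
Proof.
move=> hp hq j; rewrite coefM => nz.
have [k _ nzk] : exists2 k : 'I_j.+1, true & p`_k * q`_(j - k) != 0.
  apply: contrapT => no; move: nz; rewrite big1 ?eqxx// => k _.
  by apply/eqP; apply: contrapT => /negP nzk; apply: no; exists k.
move: nzk; rewrite mulf_eq0 negb_or => /andP[/hp[kd ok] /hq[je oj]].
have kj : (k <= j)%N by rewrite -ltnS.
by rewrite -(subnKC kj) !oddD ok oj leq_add.
Qed.

Lemma parity_polyX (R : realType) d (p : {poly R}) n :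
  parity_poly d p -> parity_poly (d * n) (p ^+ n).
Proof.
move=> hp; elim: n => [|n IH]; last by rewrite exprS mulnS; exact: parity_polyM.
by rewrite muln0 expr0 => j; rewrite coef1; case: j => //= j; rewrite eqxx.
Qed.

Lemma parity_poly_deriv (R : realType) d (p : {poly R}) :
  parity_poly d.+1 p -> parity_poly d p^`().
Proof.
move=> hp j; rewrite coef_deriv => nz.
have /hp[jd oj] : p`_j.+1 != 0 by apply: contraNneq nz => ->; rewrite mul0rn.
by split; [rewrite -ltnS|exact: negb_inj].
Qed.

Lemma parity_poly_derivn (R : realType) n d (p : {poly R}) :
  parity_poly (n + d) p -> parity_poly d p^`(n).
Proof.
elim: n d => [|n IH] d; first by rewrite derivn0.
by rewrite addSnnS derivnS => /IH; exact: parity_poly_deriv.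
Qed.

Lemma parity_polyX2 (R : realType) : parity_poly 2 ('X ^+ 2 - 1 : {poly R}).
Proof.
move=> j; rewrite coefB coefXn coef1.
by case: j => [|[|[|j]]]; rewrite /= ?subrr ?eqxx.
Qed.

Lemma parity_polyXv (R : realType) : parity_poly 1 ('X : {poly R}).
Proof. by move=> j; rewrite coefX; case: j => [|[|j]]; rewrite /= ?eqxx. Qed.

Lemma derivn_X2 (R : realType) l n : (n <= l)%N ->
  exists2 S : {poly R}, parity_poly n S &
    (('X ^+ 2 - 1) ^+ l)^`(n) = ('X ^+ 2 - 1) ^+ (l - n) * S.
Proof.
elim: n => [_|n IH nl].
  exists 1; last by rewrite derivn0 subn0 mulr1.
  exact: (parity_polyX (n := 0) (@parity_polyX2 R)).
have [S hS e] := IH (ltnW nl).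
have [k kE] : exists k, (l - n = k.+1)%N.
  by exists (l - n.+1)%N; rewrite subnSK.
exists (('X * S) *+ 2 *+ k.+1 + ('X ^+ 2 - 1) * S^`()).
  apply: parity_polyD.
    by do 2 apply: parity_polyMn; exact: parity_polyM (@parity_polyXv R) hS.
  case: n hS {e IH kE nl} => [|n] hS.
    suff -> : S^`() = 0.
      by rewrite mulr0 => j; rewrite coef0 eqxx.
    apply/polyP => j; rewrite coef_deriv coef0.
    have [->|/hS[]//] := eqVneq S`_j.+1 0; exact: mul0rn.
  exact: (parity_polyM (@parity_polyX2 R) (parity_poly_deriv hS)).
have kE' : (l - n.+1 = k)%N by rewrite subnS kE.
rewrite derivnS e kE kE' derivM deriv_exp /= derivB derivXn -polyC1 derivC.
rewrite subr0 /= expr1 polyC1 (exprSr (_ - _)) [RHS]mulrDr [in RHS]mulrA; congr (_ + _).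
rewrite !(mulrnAl, mulrnAr) !mulrA; congr (_ *+ _ *+ _).
by rewrite [X in X * _]mulrC.
Qed.

Lemma parity_poly_homog (R : realType) d (p : {poly R}) : parity_poly d p ->
  exists2 h : mpoly 3 R[i], h \is ishomog1 d mdeg &
    forall (z : R[i]) (t r : R), r != 0 ->
      complex.Re z ^+ 2 + complex.Im z ^+ 2 + t ^+ 2 = r ^+ 2 ->
      meval (tnth [tuple z; z^*; t%:C]) h = (r ^+ d * p.[t / r])%:C.
Proof.
move=> hp; pose X k : mpoly 3 R[i] := mpolyX _ (mnm1 k).
have hX k : X k \is ishomog1 1 mdeg by rewrite dhomogX; apply/eqP; exact: mdeg1.
pose N : mpoly 3 R[i] := X 0 * X 1 + X ord_max ^+ 2.
have hN : N \is ishomog1 2 mdeg.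
  by rewrite rpredD// ?(dhomogM (hX _) (hX _))//; exact: (dhomogMn 2 (hX _)).
have half j : (j <= d)%N -> odd j = odd d -> ((d - j)./2.*2 = d - j)%N.
  by move=> jd o; rewrite -[RHS]odd_double_half oddB// o addbb.
exists (\sum_(j < d.+1) if odd j == odd d then
          (p`_j)%:C *: (X ord_max ^+ j * N ^+ (d - j)./2) else 0).
  apply: rpred_sum => j _; case: ifPn => [/eqP o|_]; last exact: rpred0.
  have jd : (j <= d)%N by rewrite -ltnS.
  apply: rpredZ.
  have := dhomogM (dhomogMn j (hX ord_max)) (dhomogMn (d - j)./2 hN).
  by rewrite mul1n mul2n half// subnKC.
move=> z t r r0 e.
have zz : z * z^* = (complex.Re z ^+ 2 + complex.Im z ^+ 2)%:C.
  by case: z {e} => a b /=; simpc; rewrite !expr2 -/(_ +i* _); congr (_ +i* _); ring.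
rewrite raddf_sum /=.
have sp : (size p <= d.+1)%N.
  apply/leq_sizeP => j dj; apply/eqP; apply: contraTT dj => /hp[jd _].
  by rewrite -leqNgt.
rewrite (horner_coef_wide _ sp) mulr_sumr rmorph_sum/=.
apply: eq_bigr => j _; case: ifPn => [/eqP jd|/eqP jd]; last first.
  have [->|/hp[_ /jd//]] := eqVneq p`_j 0.
  by rewrite mul0r mulr0 rmorph0 raddf0.
rewrite mevalZ mevalM !rmorphXn/= mevalD mevalM rmorphXn/= !mevalXU.
rewrite !(tnth_nth 0)/= zz -!rmorphXn -rmorphD/= e -!rmorphXn -!rmorphM/=.
congr (_%:C); rewrite [RHS]mulrCA; congr (_ * _).
have jd' : (j <= d)%N by rewrite -ltnS.
rewrite -exprM mul2n half// expr_div_n.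
have -> : r ^+ d = r ^+ j * r ^+ (d - j) by rewrite -exprD subnKC.
by rewrite mulrCA mulrAC mulfV ?mul1r ?expf_neq0 // mulrC.
Qed.

Lemma dhomog_varM (R : realType) (k : 'I_3) j e (h : mpoly 3 R[i]) :
  h \is ishomog1 e mdeg -> mpolyX _ (mnm1 k) ^+ j * h \is ishomog1 (j + e) mdeg.
Proof.
have hX : (mpolyX _ (mnm1 k) : mpoly 3 R[i]) \is ishomog1 1 mdeg.
  by rewrite dhomogX; apply/eqP; exact: mdeg1.
by move=> hh; have := dhomogM (dhomogMn j hX) hh; rewrite mul1n.
Qed.

Lemma solid_harmonicP (R : realType) (l : nat) (m : int) : (`|m| <= l)%N ->
  is_solid_harmonic l m (solid_harmonic R l m).
Proof.
move=> ml; rewrite /solid_harmonic ml; apply: xgetPex.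
pose c : R := (-1) ^ m / (2 ^+ l * l`!%:R).
have legE (z : R[i]) (t : R) : z != 0 ->
    let n := complex.Re z ^+ 2 + complex.Im z ^+ 2 in
    let r := Num.sqrt (n + t ^+ 2) in
    [/\ 0 < r, n + t ^+ 2 = r ^+ 2, `|z| = (Num.sqrt n)%:C, 0 < Num.sqrt n &
     1 - (t / r) ^+ 2 = (Num.sqrt n / r) ^+ 2].
  move=> z0 n r.
  have n0 : 0 < n.
    rewrite lt0r addr_ge0 ?sqr_ge0// andbT.
    apply: contra z0; rewrite paddr_eq0 ?sqr_ge0// !sqrf_eq0.
    by rewrite eq_complex.
  have nt : 0 < n + t ^+ 2 by rewrite ltr_wpDr ?sqr_ge0.
  have r0 : 0 < r by rewrite sqrtr_gt0.
  have rE : r ^+ 2 = n + t ^+ 2 by rewrite sqr_sqrtr// ltW.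
  split=> //; [by rewrite normc_def|by rewrite sqrtr_gt0|].
  rewrite !expr_div_n rE sqr_sqrtr; last exact: ltW.
  by field; rewrite gt_eqF.
have legE2 (z : R[i]) (t : R) : z != 0 ->
    let r := Num.sqrt (complex.Re z ^+ 2 + complex.Im z ^+ 2 + t ^+ 2) in
    (legendre l m (t / r))%:C = c%:C * (`|z| / r%:C) ^ m *
      ((('X ^+ 2 - 1) ^+ l : {poly R})^`(absz (l%:Z + m))).[t / r]%:C.
  move=> z0 r; have [r0 _ -> n0 e] := legE z t z0.
  have pw (a : R) : 0 < a -> (a ^+ 2) `^ (m%:~R / 2) = a ^ m.
    move=> a0; rewrite -powR_mulrn ?(ltW a0)// -powRrM mulrCA divff ?pnatr_eq0//.
    by rewrite mulr1 powR_intmul// ltW.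
  rewrite /legendre e pw ?divr_gt0// -/c !rmorphM/=; congr (_ * _ * _).
  by rewrite rmorphXz ?unitfE ?gt_eqF ?divr_gt0//= fmorph_div.
move: c legE2 => c legE2; case: m ml legE2 => [j|j] ml legE2.
- have jl : (j <= l)%N by [].
  have : parity_poly (l - j) ((('X ^+ 2 - 1) ^+ l : {poly R})^`(l + j)).
    apply: parity_poly_derivn.
    have -> : (l + j + (l - j) = 2 * l)%N by rewrite -addnA subnKC// mul2n addnn.
    exact: parity_polyX (@parity_polyX2 R).
  move=> /parity_poly_homog[h hh hE].
  exists (c%:C *: (mpolyX _ (mnm1 0) ^+ j * h)); split.
    by apply: rpredZ; have := dhomog_varM 0 j hh; rewrite subnKC.
  move=> z t z0; have [r0 rE nE n0 _] := legE z t z0.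
  rewrite /= legE2//; move: r0 rE; set r := Num.sqrt _ => r0 rE.
  rewrite mevalZ mevalM rmorphXn/= mevalXU (hE _ _ r)// ?gt_eqF//.
  rewrite (tnth_nth 0)/= -!exprnP !expr_div_n !rmorphM/= !rmorphXn/=.
  have -> : r%:C ^+ l = r%:C ^+ j * r%:C ^+ (l - j) by rewrite -exprD subnKC.
  have : `|z| ^+ j != 0 by rewrite expf_neq0// normr_eq0.
  have : r%:C ^+ j != 0 by rewrite expf_neq0// fmorph_eq0 gt_eqF.
  move: (_.[_]) (r%:C ^+ j) (r%:C ^+ (l - j)) (`|z| ^+ j) (z ^+ j) => D a b e f.
  by move=> a0 e0; field; rewrite a0 e0.
- have jl : (j.+1 <= l)%N by [].
  have [S hS SE] := derivn_X2 R (leq_subr j.+1 l).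
  have [h hh hE] := parity_poly_homog hS.
  exists ((c * (-1) ^+ j.+1)%:C *: (mpolyX _ (mnm1 1) ^+ j.+1 * h)); split.
    by apply: rpredZ; have := dhomog_varM 1 j.+1 hh; rewrite subnKC.
  move=> z t z0; have [r0 rE nE n0 xE] := legE z t z0.
  rewrite /= legE2//; move: r0 rE xE; set r := Num.sqrt _ => r0 rE xE.
  rewrite mevalZ mevalM rmorphXn/= mevalXU (hE _ _ r)// ?gt_eqF//.
  have -> : absz (l%:Z + Negz j) = (l - j.+1)%N.
    by rewrite NegzE subzn//.
  rewrite SE (subKn jl) hornerM !horner_exp !hornerE.
  have qE : ((t / r) ^+ 2 - 1)%:C = - (`|z| / r%:C) ^+ 2.
    by rewrite nE -fmorph_div -rmorphXn -rmorphN/= -xE opprB.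
  have zc : `|z| ^+ 2 = z * z^*.
    rewrite nE -rmorphXn/= sqr_sqrtr ?addr_ge0 ?sqr_ge0//.
    by case: (z) => a b; simpc; rewrite !expr2; congr (_ +i* _); ring.
  rewrite (tnth_nth 0)/= NegzE -!exprnN !rmorphM/= !rmorphXn/= qE rmorphN1.
  rewrite [in RHS]exprNn !expr_div_n -exprM [(2 * _)%N]mulnC exprM exprAC zc.
  have -> : r%:C ^+ l = r%:C ^+ j.+1 * r%:C ^+ (l - j.+1).
    by rewrite -exprD subnKC.
  have : `|z| ^+ j.+1 != 0 by rewrite expf_neq0// normr_eq0.
  have : r%:C ^+ j.+1 != 0 by rewrite expf_neq0// fmorph_eq0 gt_eqF.
  have : z ^+ j.+1 != 0 by rewrite expf_neq0.
  rewrite [in RHS]exprMn [r%:C ^+ 2 ^+ _]exprAC.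
  move: (S.[_]) (r%:C ^+ j.+1) (r%:C ^+ (l - j.+1)) (`|z| ^+ j.+1) (z ^+ j.+1)
    (z^* ^+ j.+1) ((-1) ^+ j.+1) => D a b e f g o.
  by move=> f0 a0 e0; field; rewrite f0 a0 e0.
Qed.

Lemma Ures_plus_sub (R : realType) : @Ures_plus R `<=` @Ures R.
Proof.
move=> f hf j; have [p hp] := hf j; exists p, 0%N => Z hZ.
by rewrite hp// expr0 divr1.
Qed.

Lemma U'res_plus_sub (R : realType) : @U'res_plus R `<=` @U'res R.
Proof.
move=> f hf j; have [p hp] := hf j; exists p, 0%N => Z hZ.
by rewrite hp// expr0 divr1.
Qed.

Definition Npoly (R : realType) : mpoly 3 R[i] :=
  mpolyX _ (mnm1 0) * mpolyX _ (mnm1 1) + mpolyX _ (mnm1 ord_max) ^+ 2.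

Lemma det2E (K : comNzRingType) (A : 'M[K]_2) :
  \det A = A 0 0 * A 1 1 - A 0 1 * A 1 0.
Proof.
rewrite (expand_det_row _ 0) !big_ord_recl big_ord0 addr0 /cofactor !det_mx11.
rewrite !mxE expr0 mul1r expr1 mulN1r mulrN.
by congr (_ * A _ _ - A _ _ * A _ _); apply/val_inj.
Qed.

Lemma peval_Npoly (R : realType) (Z : 'M[R[i]]_2) :
  Z^T = Z -> peval (Npoly R) Z = \det Z.
Proof.
move=> sZ; rewrite /peval mevalD mevalM rmorphXn/= !mevalXU /coords.
rewrite !(tnth_nth 0)/= det2E exprMn sqrrN sqrCi.
have -> : Z 1 0 = Z 0 1 by rewrite -{1}sZ mxE.
by rewrite mulN1r expr2.
Qed.

Lemma pevalD (R : realType) p q (Z : 'M[R[i]]_2) :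
  peval (p + q) Z = peval p Z + peval q Z.
Proof. exact: mevalD. Qed.

Lemma pevalM_Npoly (R : realType) p n (Z : 'M[R[i]]_2) : Z^T = Z ->
  peval (p * Npoly R ^+ n) Z = peval p Z * \det Z ^+ n.
Proof.
by move=> /peval_Npoly <-; rewrite /peval mevalM rmorphXn.
Qed.

Lemma is_PD (R : realType) (h1 h2 : 'M[R[i]]_2 -> R[i]) :
  is_P h1 -> is_P h2 -> is_P (fun Z => h1 Z + h2 Z).
Proof.
move=> [p [n hp]] [q [k hq]].
exists (p * Npoly R ^+ k + q * Npoly R ^+ n), (n + k)%N => Z hZ.
have [sZ d0] := hZ.
rewrite hp// hq// pevalD !pevalM_Npoly// exprD.
have := expf_neq0 n d0; have := expf_neq0 k d0.
move: (\det Z ^+ n) (\det Z ^+ k) (peval p Z) (peval q Z) => a b c d b0 a0.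
by field; rewrite a0 b0.
Qed.

Lemma is_P_Nexp (R : realType) (k : int) (p : mpoly 3 R[i]) :
  is_P (fun Z => \det Z ^ k * peval p Z).
Proof.
case: k => k; last by exists p, k.+1 => Z _; rewrite mulrC.
by exists (p * Npoly R ^+ k), 0%N => Z [sZ _]; rewrite pevalM_Npoly// divr1 mulrC.
Qed.

Lemma is_PZ (R : realType) (c : R[i]) (h : 'M[R[i]]_2 -> R[i]) :
  is_P h -> is_P (fun Z => c * h Z).
Proof.
move=> [p [n hp]]; exists (c *: p), n => Z hZ.
by rewrite hp// /peval mevalZ mulrA.
Qed.

Lemma Cspan_sub (R : realType) (S : set ('M[R[i]]_2 -> R[i] -> 'M[R[i]]_2)) :
  S `<=` @Wres R -> Cspan S `<=` @Wres R.
Proof.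
move=> SW F [n [c [G [SG FE]]]]; split.
  move=> Z s Zs; rewrite FE//; apply/matrixP => u v; rewrite mxE !summxE.
  by apply: eq_bigr => j _; rewrite !mxE -[in LHS](SW _ (SG j)).1// mxE.
move=> u v.
suff [h hP hE] : exists2 h, is_P h & forall Z s, on_cover Z s ->
    \sum_j c j * G j Z s u v = s * h Z.
  exists h => // Z s Zs; rewrite FE// summxE -hE//.
  by apply: eq_bigr => j _; rewrite mxE.
elim: n c G SG {FE} => [|n IH] c G SG.
  exists (fun=> 0); last by move=> Z s _; rewrite big_ord0 mulr0.
  by exists 0, 0%N => Z _; rewrite /peval meval0 mul0r.
have [h hP hE] := IH (c \o lift ord0) (G \o lift ord0) (fun j => SG _).
have [h' hP' hE'] := (SW _ (SG ord0)).2 u v.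
exists (fun Z => c ord0 * h' Z + h Z).
  by apply: is_PD => //; exact: is_PZ.
by move=> Z s Zs; rewrite big_ord_recl hE// hE'// mulrDr mulrCA.
Qed.

Lemma Wentry (R : realType) (c d : R[i]) (k : int) l m :
  exists2 h, @is_P R h & forall Z s, on_cover Z s ->
    c * s ^ (2 * k + 1) * (d * RR l m Z) = s * h Z.
Proof.
exists (fun Z => c * d * (\det Z ^ k * RR l m Z)).
  by apply: is_PZ; exact: is_P_Nexp.
move=> Z s [[_ d0] sE]; have s0 : s != 0.
  by apply: contraNneq d0 => s0; rewrite -sE s0 expr0n.
rewrite expfzDr// expr1z -exprz_exp -exprnP sE.
move: (\det Z ^ k) (RR l m Z) => a b; ring.
Qed.

Lemma Wres_mx2 (R : realType) (a b d c : R[i]) (k : int) l (m1 m2 m3 : int) :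
  @Wres R (fun Z s => (c * s ^ (2 * k + 1)) *:
    mx2 (a * RR l m1 Z) (b * RR l m2 Z) (b * RR l m2 Z) (d * RR l m3 Z)).
Proof.
split=> [Z s _|u v].
  apply/matrixP => u v; rewrite !mxE; congr (_ * _).
  by case: (u == 0); case: (v == 0).
have [x [m hm]] : exists x m, forall Z : 'M[R[i]]_2,
    mx2 (a * RR l m1 Z) (b * RR l m2 Z) (b * RR l m2 Z) (d * RR l m3 Z) u v
    = x * RR l m Z.
  case E : (u == 0); case E' : (v == 0).
  - by exists a, m1 => Z; rewrite !mxE E E'.
  - by exists b, m2 => Z; rewrite !mxE E E'.
  - by exists b, m2 => Z; rewrite !mxE E E'.
  - by exists d, m3 => Z; rewrite !mxE E E'.
have [h hP hE] := Wentry c x k l m.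
by exists h => // Z s Zs; rewrite mxE hm hE.
Qed.

Lemma WresD (R : realType) (F G : 'M[R[i]]_2 -> R[i] -> 'M[R[i]]_2) :
  Wres F -> Wres G -> Wres (fun Z s => F Z s + G Z s).
Proof.
move=> [Fs Fh] [Gs Gh]; split=> [Z s Zs|u v].
  by rewrite raddfD/= Fs// Gs.
have [h hP hE] := Fh u v; have [h' hP' hE'] := Gh u v.
exists (fun Z => h Z + h' Z); first exact: is_PD.
by move=> Z s Zs; rewrite mxE hE// hE'// mulrDr.
Qed.

Lemma Wres_ext (R : realType) (F G : 'M[R[i]]_2 -> R[i] -> 'M[R[i]]_2) :
  (forall Z s, F Z s = G Z s) -> Wres F -> Wres G.
Proof. by move=> FG; congr Wres; apply/funext => Z; apply/funext => s. Qed.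

Lemma NstarM_Wres (R : realType) k l m :
  @Wres R (NstarM k 1 l m) /\ @Wres R (NstarM k (-1) l m).
Proof.
have H j : @Wres R (NstarM j 1 l m).
  apply: Wres_ext (Wres_mx2 (((l%:Z + m) * (l%:Z - m + 1))%:~R)
    (- 'i * m%:~R) 1 1 j l (m - 1) m (m + 1)).
  by move=> Z s; rewrite !mul1r.
split; first exact: H.
apply: Wres_ext (H (k - 1)) => Z s; congr (_ ^ _ *: _); lia.
Qed.

Lemma starC_Wres (R : realType) k l m : @Wres R (starC k l m).
Proof.
apply: WresD.
  apply: Wres_ext (Wres_mx2 (((l.+1%:Z - m) * (l.+1%:Z - m + 1))%:~R)
    (- 'i * (l.+1%:Z - m)%:~R) (-1) ((2 * k + 1) * l%:Z)%:~R (k - 1) l.+1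
    (m - 1) m (m + 1)).
  move=> Z s; rewrite mulN1r (_ : 2 * (k - 1) + 1 = 2 * k - 1)//; lia.
apply: Wres_ext (Wres_mx2 (((l.-1%:Z + m) * (l.-1%:Z + m + 1))%:~R)
    ('i * (l.-1%:Z + m + 1)%:~R) (-1) (2 * (k + l%:Z + 1) * (l%:Z + 1))%:~R
    k l.-1 (m - 1) m (m + 1)).
by move=> Z s; rewrite mulN1r.
Qed.

Lemma Wgens_plus_Wres (R : realType) : Cspan (@Wgens_plus R) `<=` @Wres R.
Proof.
apply: Cspan_sub => G [k [l [m [_ _ [->|[_ ->]]]]]]; last exact: starC_Wres.
exact: (NstarM_Wres _ _ _ _).1.
Qed.

Lemma Wgens_minus_Wres (R : realType) : Cspan (@Wgens_minus R) `<=` @Wres R.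
Proof.
apply: Cspan_sub => G [k [l [m [_ _ [->|[_ ->]]]]]]; last exact: starC_Wres.
exact: (NstarM_Wres _ _ _ _).2.
Qed.

(* At (X, zeta) = (1, 1) the frame is (- b_1, b_2, - b_3), where (b_1, b_2, b_3)
   is the positive basis fixing the orientation. *)
Lemma Gam_frame_base (R : realType) :
  [/\ @Gam R 0 (pi / 2) 0 = 1%:M,
      Gam_frame 0 (pi / 2) 0 0 = - ('i^-1 *: mx2 1 0 0 1 : 'M[R[i]]_2),
      Gam_frame 0 (pi / 2) 0 1 = mx2 0 (- 'i) (- 'i) (0 : R[i]) &
      Gam_frame 0 (pi / 2) 0 ord_max = - mx2 (- 'i) 0 0 ('i : R[i])].
Proof.
have mxd (h : R -> 'M[R[i]]_2) (a b c d e f : R -> R) (a' b' c' d' e' f' x : R) :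
    (forall y, h y =
      mx2 (a y +i* b y) (c y +i* d y) (c y +i* d y) (e y +i* f y)) ->
    is_derive x (1 : R) a a' -> is_derive x (1 : R) b b' ->
    is_derive x (1 : R) c c' -> is_derive x (1 : R) d d' ->
    is_derive x (1 : R) e e' -> is_derive x (1 : R) f f' ->
    mxderive h x = mx2 (a' +i* b') (c' +i* d') (c' +i* d') (e' +i* f').
  move=> hE ha hb hc hd he hf; apply/matrixP => u v.
  rewrite !mxE /cderive !derive1E.
  have rI y : complex.Re (h y u v) = if u == 0 then (if v == 0 then a y else c y)
      else (if v == 0 then c y else e y).
    by rewrite hE mxE; case: (u == 0); case: (v == 0).
  have iI y : complex.Im (h y u v) = if u == 0 then (if v == 0 then b y else d y)
      else (if v == 0 then d y else f y).
    by rewrite hE mxE; case: (u == 0); case: (v == 0).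
  under eq_fun do rewrite rI; under [X in _ +i* 'D_1 X x]eq_fun do rewrite iI.
  by case: (u == 0); case: (v == 0); rewrite !derive_val.
have explicit a th ph : @Gam R a th ph = mx2
    (sin th * (cos a * cos ph - sin a * sin ph) +i*
       (sin th * (cos a * sin ph + sin a * cos ph)))
    (- (sin a * cos th) +i* (cos a * cos th))
    (- (sin a * cos th) +i* (cos a * cos th))
    (sin th * (cos a * cos ph + sin a * sin ph) +i*
       (sin th * (sin a * cos ph - cos a * sin ph))).
  apply/matrixP => u v; rewrite !mxE -complexiE /expi.
  by case: (u == 0); case: (v == 0); simpc; congr (_ +i* _); ring.
split.
- rewrite explicit cos0 sin0 sin_pihalf cos_pihalf.
  apply/matrixP => u v; rewrite !mxE.
  by case: u => [[|[|//]] ?]; case: v => [[|[|//]] ?]; rewrite /=; congr (_ +i* _); ring.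
- rewrite /Gam_frame (tnth_nth 0)/=.
  rewrite (@mxd _ cos sin (cst 0) (cst 0) cos sin
    (- sin 0) (cos 0) 0 0 (- sin 0) (cos 0)); last first.
    by move=> y; rewrite explicit cos0 sin0 sin_pihalf cos_pihalf /cst;
      congr mx2; congr (_ +i* _); ring.
  rewrite invCi -complexiE cos0 sin0; apply/matrixP => u v; rewrite !mxE.
  by case: (u == 0); case: (v == 0); rewrite ?mulr0 ?mulr1; simpc.
- rewrite /Gam_frame (tnth_nth 0)/=.
  rewrite (@mxd _ sin (cst 0) (cst 0) cos sin (cst 0)
    (cos (pi / 2)) 0 0 (- sin (pi / 2)) (cos (pi / 2)) 0); last first.
    by move=> y; rewrite explicit cos0 sin0 /cst;
      congr mx2; congr (_ +i* _); ring.
  rewrite -complexiE sin_pihalf cos_pihalf; apply/matrixP => u v; rewrite !mxE.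
  by case: (u == 0); case: (v == 0); simpc.
- rewrite /Gam_frame (tnth_nth 0)/=.
  rewrite (@mxd _ cos sin (cst 0) (cst 0) cos (- sin : R -> R)
    (- sin 0) (cos 0) 0 0 (- sin 0) (- cos 0)); last first.
    by move=> y; rewrite explicit cos0 sin0 sin_pihalf cos_pihalf /cst;
      congr mx2; congr (_ +i* _); rewrite ?fctE; ring.
  rewrite -complexiE cos0 sin0; apply/matrixP => u v; rewrite !mxE.
  by case: (u == 0); case: (v == 0); simpc.
Qed.

(* Main.v *)
Require Import Defs.
From HB Require Import structures.
From mathcomp Require Import all_boot all_order all_algebra.
From mathcomp Require Import all_classical all_reals all_analysis.
From mathcomp Require Import complex ring lra zify.
From mathcomp Require Import -(notations) mpoly.
Set Implicit Arguments.
Unset Strict Implicit.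
Unset Printing Implicit Defensive.
Import Order.TTheory GRing.Theory Num.Theory.
Import numFieldNormedType.Exports.
Local Open Scope ring_scope.

(** On the cycle write Z = zeta X with X on the unit sphere, zeta = e^(i a) and
    N(Z)^(1/2) = zeta; then dZ^3 = - i zeta^3 sin(theta) da dtheta dphi.  Hence
    a monomial in zeta and the entries of X integrates to 0 unless zeta occurs
    with exponent -3.  Moreover R^m_l is orthogonal on the sphere to the
    polynomials of degree < l: where z != 0, it is z^m times a multiple of the
    derivative of order l + m of (t^2 - 1)^l, and one integrates by parts l + m
    times.

    For g, f polynomial, the exponent condition and k >= -(l + 1) leave only
    products of a harmonic with a polynomial of smaller degree; the term in
    T_(l-1) that would be an exception, k = -(l + 1), has coefficient 0.

    In the other case g = N^-1 p(Z^-1) Z and f = N^-1 Z q(Z^-1) with p, q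
    polynomial, so that F is replaced by Z F Z.  By Cayley-Hamilton
    X A X = tr(X A) X - adj A on the sphere, and the contiguity relations of the
    Legendre functions give tr(X M_l) = 0, tr(X T_(l-1)) = - 2 l R_l,
    tr(X B_(l+1)) = 2 (l + 1) R_l and (2 l + 1) R_l X = - adj T_(l-1) + (terms
    in R_(l+1)).  Thus Z C_(k,l) Z has no component in R_(l-1) when k = -1, the
    only case in which such a component could contribute. *)

(** * Derivatives of Rodrigues polynomials *)

Section Rodrigues.
Variable R : realType.
Implicit Types (p q : {poly R}) (n l m : int).

(** The scaling makes the l-th derivative the Legendre polynomial P_l. Below, W_l stands for this
    polynomial. *)
Definition rodrigues (l : nat) : {poly R} :=
  (2 ^+ l * l`!%:R)^-1 *: ('X ^+ 2 - 1) ^+ l.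

Lemma deriv_X2 : ('X ^+ 2 - 1 : {poly R})^`() = 'X *+ 2.
Proof. by rewrite derivB derivXn -polyC1 derivC subr0 /= expr1. Qed.

Lemma rodriguesS (l : nat) :
  (l.+1%:R *+ 2) *: rodrigues l.+1 = ('X ^+ 2 - 1) * rodrigues l.
Proof.
rewrite /rodrigues scalerA [('X ^+ 2 - 1) ^+ l.+1]exprS -scalerAr; congr (_ *: _).
rewrite exprS factS natrM; field.
by rewrite addrC natr1 expf_eq0 !pnatr_eq0 andbF -lt0n fact_gt0.
Qed.

Lemma deriv_rodrigues (l : nat) : (rodrigues l.+1)^`() = 'X * rodrigues l.
Proof.
rewrite /rodrigues derivZ deriv_exp /= deriv_X2 -[in RHS]scalerAr.
rewrite mulrnAl -mulrnA -[('X * _) *+ _]scaler_nat scalerA; congr (_ *: _).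
rewrite exprS factS !natrM; field.
by rewrite addrC natr1 expf_eq0 !pnatr_eq0 andbF -lt0n fact_gt0.
Qed.

(* With value 0 at negative indices, the recurrences below hold for all the
   indices at which they are used, boundary cases included. *)
Definition drod n l : {poly R} :=
  match n, l with Posz n, Posz l => (rodrigues l)^`(n) | _, _ => 0 end.

(** Leibniz's rule, in which only two terms survive. At n = 0 the predecessor truncates to 0, and
    its term has coefficient 0. *)
Lemma derivnXM p (n : nat) : ('X * p)^`(n) = 'X * p^`(n) + p^`(n.-1) *+ n.
Proof.
elim: n => [|n IH]; first by rewrite !derivn0 mulr0n addr0.
rewrite derivnS IH derivD derivMn derivM derivX mul1r -derivnS.
case: n {IH} => [|n]; first by rewrite !derivn0 mulr0n addr0 mulr1n addrC.
by rewrite /= -derivnS addrAC -mulrS addrC.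
Qed.

Lemma drod_lt0 n l : n < 0 -> drod n l = 0.
Proof. by case: n. Qed.

Lemma drod_succ n l : 0 <= n -> 0 <= l ->
  drod (n + 1) (l + 1) = 'X * drod n l + n%:~R * drod (n - 1) l.
Proof.
case: n l => [n|//] [l|//] _ _.
rewrite -!PoszD !addn1 /drod derivSn deriv_rodrigues derivnXM.
case: n => [|n]; first by rewrite mulr0n mul0r.
by rewrite -[_ *+ _]mulr_natl /= subn1.
Qed.

(** Leibniz's rule for the n-th derivative of (X^2 - 1) W_l, which [rodriguesS] identifies with 2 (l
    + 1) W_(l+1). *)
Lemma drod_X2 n l : 0 <= l ->
  (2 * (l + 1))%:~R * drod n (l + 1) =
  ('X ^+ 2 - 1) * drod n l + (2 * n)%:~R * 'X * drod (n - 1) l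
  + (n * (n - 1))%:~R * drod (n - 2) l.
Proof.
case: l => [l|//] _; case: n => [n|n]; last first.
  by rewrite !drod_lt0 ?mulr0 ?addr0//; lia.
(* The factor X^2 is split into two multiplications by X, so that [derivnXM] applies twice. *)
have e : (2 * (l%:Z + 1))%:~R * (rodrigues l.+1)^`(n) =
    ('X * ('X * rodrigues l) - rodrigues l)^`(n).
  rewrite mulrA -expr2 -[X in _ - X]mul1r -mulrBl -rodriguesS derivnZ.
  have -> : l.+1%:R *+ 2 = (2 * l.+1)%:R :> R by rewrite mulnC natrM mulr_natr.
  by rewrite scaler_nat -[RHS]mulr_natl -PoszD addn1.
rewrite (_ : drod n (l%:Z + 1) = (rodrigues l.+1)^`(n)) ?e; last first.
  by rewrite -PoszD addn1.
rewrite derivnB !derivnXM {e}.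
case: n => [|[|n]] /=.
- by ring.
- by ring.
rewrite (_ : (n.+2 - (0 + 1).+1)%N = n); last by rewrite add0n subn2.
move: (_^`(n)) => u; move: (u^`()) => v; move: (v^`()) => w.
by ring.
Qed.

(** Differentiated l times, this is the classical relation P'_(l+1) - P'_(l-1) = (2 l + 1) P_l.
    Writing W_(l-1) through [drod] gives 0 at l = 0. *)
Lemma deriv2_rodrigues (l : nat) :
  (rodrigues l.+1)^`()^`() = (2 * l%:Z + 1)%:~R * rodrigues l + drod 0 (l%:Z - 1).
Proof.
rewrite deriv_rodrigues derivM derivX mul1r.
case: l => [|l].
  have -> : (rodrigues 0)^`() = 0.
    by rewrite /rodrigues expr0 derivZ -polyC1 derivC scaler0.
  by rewrite [drod _ _]/(0 : {poly R}) mulr0 !addr0 mulr0 add0r mul1r.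
rewrite deriv_rodrigues (_ : l.+1%:Z - 1 = l); last by lia.
rewrite /= mulrA -expr2.
have -> : 'X ^+ 2 * rodrigues l = (l.+1%:R *+ 2) *: rodrigues l.+1 + rodrigues l.
  by rewrite rodriguesS; ring.
have -> : l.+1%:R *+ 2 = (2 * l.+1)%:R :> R by rewrite mulnC natrM mulr_natr.
rewrite scaler_nat -[_ *+ (2 * _)]mulr_natl addrA; congr (_ + _).
by move: (rodrigues _) => u; ring.
Qed.

Lemma drod_succ2 n l : 0 <= n -> 0 <= l ->
  drod (n + 2) (l + 1) = (2 * l + 1)%:~R * drod n l + drod n (l - 1).
Proof.
case: n l => [n|//] [l|//] _ _; rewrite -(PoszD n 2) -(PoszD l 1) addn1 addn2.
rewrite [LHS]/drod !derivSn deriv2_rodrigues derivnD !mulrzl raddfMz; congr (_ + _).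
rewrite /drod; case: (l%:Z - 1) => k //=.
by rewrite linear0.
Qed.

(** Elimination of [drod (n - 1) l] between [drod_succ] at n and [drod_succ2] at n - 1; n = 0 is
    separate because the latter needs a nonnegative order. *)
Lemma drodXM n l : 0 <= n -> 0 <= l ->
  (2 * l + 1)%:~R * 'X * drod n l =
  (2 * l + 1 - n)%:~R * drod (n + 1) (l + 1) + n%:~R * drod (n - 1) (l - 1).
Proof.
move=> n0 l0; have [->|nn0] := eqVneq n 0.
  by rewrite drod_succ//; ring.
have := @drod_succ2 (n - 1) l; rewrite (_ : n - 1 + 2 = n + 1); last by lia.
have n1 : 0 <= n - 1 by lia.
move=> /(_ n1 l0) e.
have -> : drod (n - 1) (l - 1)
    = drod (n + 1) (l + 1) - (2 * l + 1)%:~R * drod (n - 1) l by rewrite e; ring.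
by rewrite drod_succ//; ring.
Qed.

(** Linear combination of [drod_X2], [drod_succ] at n - 1 and [drod_succ2] at n - 2. *)
Lemma drod1X2M n l : 0 <= l ->
  (2 * l + 1)%:~R * (1 - 'X ^+ 2) * drod n l =
  (n * (n - 1))%:~R * drod (n - 2) (l - 1)
  - ((2 * l + 1 - n) * (2 * l + 2 - n))%:~R * drod n (l + 1).
Proof.
move=> l0; have [n0|n0] := ltP n 0.
  by rewrite !drod_lt0 ?mulr0 ?subr0//; lia.
have e2 := drod_X2 n l0.
(* The factors n here and n (n - 1) in [e3] vanish exactly where the orders n - 1 and n - 2 leave
   the range of the recurrences. *)
have e1 : n%:~R * drod n (l + 1)
    = n%:~R * ('X * drod (n - 1) l + (n - 1)%:~R * drod (n - 2) l).
  have [->|nn0] := eqVneq n 0; first by rewrite !mul0r.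
  have n1 : 0 <= n - 1 by lia.
  by have := drod_succ n1 l0; rewrite subrK (_ : n - 1 - 1 = n - 2) => [->//|]; lia.
have e3 : (n * (n - 1))%:~R * drod n (l + 1) = (n * (n - 1))%:~R *
    ((2 * l + 1)%:~R * drod (n - 2) l + drod (n - 2) (l - 1)).
  have [->|nn0] := eqVneq n 0; first by rewrite !mul0r.
  have [->|nn1] := eqVneq n 1; first by rewrite subrr mulr0 !mul0r.
  have n2 : 0 <= n - 2 by lia.
  by have := drod_succ2 n2 l0; rewrite subrK => ->.
move: e1 e2 e3; move: (drod n l) (drod (n - 1) l) (drod (n - 2) l)
  (drod (n - 2) (l - 1)) (drod n (l + 1)) => a b c d e e1 e2 e3.
have z1 : n%:~R * ('X * b + (n - 1)%:~R * c) - n%:~R * e = 0.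
  by rewrite e1 subrr.
have z2 : (2 * (l + 1))%:~R * e - (('X ^+ 2 - 1) * a + (2 * n)%:~R * 'X * b
    + (n * (n - 1))%:~R * c) = 0 by rewrite e2 subrr.
have z3 : (n * (n - 1))%:~R * ((2 * l + 1)%:~R * c + d)
    - (n * (n - 1))%:~R * e = 0 by rewrite e3 subrr.
apply: subr0_eq.
(* The coefficients are chosen so that [b] and [c], the derivatives of orders n - 1 and n - 2,
   cancel. *)
transitivity ((2 * (2 * l + 1))%:~R * (n%:~R * ('X * b + (n - 1)%:~R * c)
    - n%:~R * e) - ((n * (n - 1))%:~R * ((2 * l + 1)%:~R * c + d)
    - (n * (n - 1))%:~R * e) + (2 * l + 1)%:~R * ((2 * (l + 1))%:~R * e -
    (('X ^+ 2 - 1) * a + (2 * n)%:~R * 'X * b + (n * (n - 1))%:~R * c))).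
  by ring.
by rewrite z1 z2 z3 !mulr0 subr0 addr0.
Qed.

End Rodrigues.

(** * Associated Legendre functions: contiguity relations and orthogonality *)

Section Legendre.
Variable R : realType.
Implicit Types (p q u : {poly R}) (n l m : int).

(* On the unit sphere, R^m_l = z^m * alegendre l m (t) when z != 0. *)
Definition alegendre l m : {poly R} := ((-1) ^ m) *: drod R (l + m) l.

Lemma signzS m : (-1) ^ (m + 1) = - (-1) ^ m :> R.
Proof. by rewrite expfzDr ?expr1z ?mulrN1// oppr_eq0 oner_eq0. Qed.

Lemma signzP m : (-1) ^ (m - 1) = - (-1) ^ m :> R.
Proof. by rewrite -[m in RHS](subrK 1) signzS opprK. Qed.

(** This relation and the next two expand z R^m_l, t R^m_l and conj(z) R^m_l on the unit sphere in
    harmonics of degrees l - 1 and l + 1, after multiplication by z^(m+1), z^m and z^(m-1); in the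
    third, 1 - t^2 = z conj(z). *)
Lemma alegendre_up l m : 0 <= l -> - l <= m ->
  (2 * l + 1)%:~R * alegendre l m
  = alegendre (l - 1) (m + 1) - alegendre (l + 1) (m + 1).
Proof.
move=> l0 lm; rewrite /alegendre signzS !scaleNr opprK [RHS]addrC -scalerAr.
rewrite -scalerBr; congr (_ *: _).
have lm0 : 0 <= l + m by lia.
have -> : l + 1 + (m + 1) = l + m + 2 by lia.
have -> : l - 1 + (m + 1) = l + m by lia.
by rewrite drod_succ2// addrK.
Qed.

Lemma alegendreXM l m : 0 <= l -> - l <= m ->
  (2 * l + 1)%:~R * 'X * alegendre l m
  = (l - m + 1)%:~R * alegendre (l + 1) m + (l + m)%:~R * alegendre (l - 1) m.
Proof.
move=> l0 lm; rewrite /alegendre -!scalerAr -scalerDr; congr (_ *: _).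
have lm0 : 0 <= l + m by lia.
rewrite drodXM//; congr (_%:~R * drod R _ _ + _ * drod R _ _); lia.
Qed.

Lemma alegendre_down l m : 0 <= l ->
  (2 * l + 1)%:~R * (1 - 'X ^+ 2) * alegendre l m
  = ((l - m + 1) * (l - m + 2))%:~R * alegendre (l + 1) (m - 1)
    - ((l + m - 1) * (l + m))%:~R * alegendre (l - 1) (m - 1).
Proof.
move=> l0; rewrite /alegendre signzP !scaleNr !mulrN -!scalerAr opprK.
rewrite [RHS]addrC -scalerBr; congr (_ *: _).
rewrite drod1X2M//; congr (_%:~R * drod R _ _ - _%:~R * drod R _ _); lia.
Qed.

(** For m > l the order l + m exceeds the degree 2 l of W_l; for m < - l it is negative. This agrees
    with the convention R^m_l = 0. *)
Lemma alegendre_out l m : l < `|m| -> alegendre l m = 0.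
Proof.
move=> lm; rewrite /alegendre; case: l lm => [l|l] lm; last first.
  by rewrite /drod; case: (_ + _) => *; rewrite scaler0.
have [lm0|lm0] := ltP (l%:Z + m) 0; first by rewrite drod_lt0 ?scaler0.
have [k -> kl] : exists2 k : nat, (l%:Z + m = k%:Z) & (2 * l < k)%N.
  by exists (absz (l%:Z + m)%R); lia.
rewrite /drod /rodrigues derivnZ derivn_poly0 ?scaler0//.
by rewrite (leq_trans (size_poly_exp_leq _ _))// -polyC1 size_XnsubC//=; lia.
Qed.

(** Vanishing of the integral over [-1, 1], expressed by an antiderivative so that integration by
    parts stays within polynomials. *)
Definition zero_mean u := exists2 P, P^`() = u & P.[1] = P.[-1].

Lemma zero_mean0 : zero_mean 0.
Proof. by exists 0; rewrite ?linear0 ?horner0. Qed.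

Lemma zero_meanZ (c : R) u : zero_mean u -> zero_mean (c *: u).
Proof. by move=> [P <- e]; exists (c *: P); rewrite ?derivZ// !hornerZ e. Qed.

Lemma dvdp_deriv_X2 (a : nat) q :
  ('X ^+ 2 - 1) ^+ a %| q -> ('X ^+ 2 - 1) ^+ a.-1 %| q^`().
Proof.
case: a => [|a]; first by rewrite !dvd1p.
move=> /dvdpP[s ->]; rewrite derivM /= deriv_exp /= [('X ^+ 2 - 1) ^+ a.+1]exprS.
apply/dvdpP; exists (s^`() * ('X ^+ 2 - 1) + s * ('X ^+ 2 - 1)^`() *+ a.+1).
move: ('X ^+ 2 - 1) => p; move: (p ^+ a) (s^`()) (p^`()) => u v w.
by ring.
Qed.

Lemma dvdp_derivn_X2 (a k : nat) q :
  ('X ^+ 2 - 1) ^+ a %| q -> ('X ^+ 2 - 1) ^+ (a - k) %| q^`(k).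
Proof.
move=> aq; elim: k => [|k IH]; first by rewrite derivn0 subn0.
by rewrite derivnS subnS; exact: dvdp_deriv_X2.
Qed.

Lemma horner_dvd_X2 (a : nat) q (x : R) : (0 < a)%N -> x ^+ 2 = 1 ->
  ('X ^+ 2 - 1) ^+ a %| q -> q.[x] = 0.
Proof.
case: a => // a _ x1 /dvdpP[s ->].
have x0 : ('X ^+ 2 - 1).[x] = 0 by rewrite !hornerE x1 subrr.
by rewrite [_ ^+ a.+1]exprS !hornerM x0 mul0r mulr0.
Qed.

(* Integration by parts N times; the boundary terms vanish since either q or
   w^`(N) keeps a factor 'X ^+ 2 - 1. *)
Lemma zero_mean_parts (N a n : nat) q (w : {poly R}) :
  ('X ^+ 2 - 1) ^+ a %| q -> ('X ^+ 2 - 1) ^+ n %| w ->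
  (N <= a + n)%N -> (size q <= N)%N -> zero_mean (q * w^`(N)).
Proof.
move=> + wn; elim: N a q => [|N IH] a q aq Nan qN.
  by move: qN; rewrite leqn0 size_poly_eq0 => /eqP ->; rewrite mul0r; exact: zero_mean0.
have [P dP eP] : zero_mean (q^`() * w^`(N)).
  apply: (IH a.-1 _ (dvdp_deriv_X2 aq)); first by lia.
  have [->|q0] := eqVneq q 0; first by rewrite linear0 size_poly0.
  by rewrite -ltnS (leq_trans _ qN)// lt_size_deriv.
exists (q * w^`(N) - P).
  by rewrite derivB derivM dP -derivnS addrAC subrr add0r.
suff z (x : R) : x ^+ 2 = 1 -> (q * w^`(N)).[x] = 0.
  by rewrite !hornerD !hornerN eP !z ?expr1n ?sqrrN ?expr1n.
move=> x1; rewrite hornerM; case: a aq Nan => [|a] aq Nan; last first.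
  by rewrite (@horner_dvd_X2 a.+1) ?mul0r.
rewrite [_.[x] in X in _ * X](@horner_dvd_X2 (n - N)) ?mulr0//; first by lia.
exact: dvdp_derivn_X2.
Qed.

(** Orthogonality of R^m_l to z^b conj(z)^c t^e of degree below l. The condition b + m = c says that
    the product has no dependence on phi; z^b z^m conj(z)^c is then (1 - t^2)^c. *)
Lemma zero_mean_alegendre (l b c e : nat) m : b%:Z + m = c -> (b + c + e < l)%N ->
  zero_mean ((1 - 'X ^+ 2) ^+ c * 'X ^+ e * alegendre l m).
Proof.
move=> bmc bce; rewrite /alegendre.
have [k kE] : exists k : nat, l%:Z + m = k%:Z by exists (absz (l%:Z + m)%R); lia.
rewrite kE -scalerAr; apply: zero_meanZ => /=.
(* One integrates by parts l + m times: l + m <= c + l because m = c - b, and the other factor has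
   degree 2 c + e < l + m because b + c + e < l. *)
apply: (@zero_mean_parts _ c l).
- by rewrite dvdp_mulr// -[1 - _]opprB exprNn dvdp_mull.
- by rewrite /rodrigues dvdpZr// invr_eq0 mulf_neq0 ?expf_neq0 ?pnatr_eq0 -?lt0n ?fact_gt0.
- by lia.
- rewrite (leq_trans (size_polyMleq _ _))// size_polyXn.
  have : (size ((1 - 'X ^+ 2 : {poly R}) ^+ c) <= 2 * c + 1)%N.
    rewrite -[1 - _]opprB exprNn -signr_odd; case: odd;
    rewrite ?expr1 ?expr0 ?mulN1r ?mul1r ?size_polyN;
    by rewrite (leq_trans (size_poly_exp_leq _ _))// -polyC1 size_XnsubC//=; lia.
  by move: (size _) => z; lia.
Qed.

End Legendre.

(** * Complex-valued integrals *)

Section Integrals.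
Local Open Scope classical_set_scope.
Local Open Scope complex_scope.
Variable R : realType.
Implicit Types (a b x : R) (f g : R -> R) (h : R -> R[i]).

Lemma Rintegral_deriv f g a b : a < b -> continuous f ->
  (forall x, is_derive x (1 : R) g (f x)) ->
  Rintegral (@lebesgue_measure R) `[a, b] f = g b - g a.
Proof.
move=> ab cf dg.
have cg : continuous g.
  by move=> x; apply: differentiable_continuous; apply/derivable1_diffP; case: (dg x).
rewrite /Rintegral (@continuous_FTC2 _ f g)//.
- by apply: continuous_subspaceT.
- split; first by move=> x _; case: (dg x).
  + by apply: cvg_at_right_filter; exact: cg.
  + by apply: cvg_at_left_filter; exact: cg.
- by move=> x _; rewrite derive1E derive_val.
Qed.

Definition ccontinuous h :=
  continuous (fun x => complex.Re (h x)) /\ continuous (fun x => complex.Im (h x)).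

Lemma continuous_integrable f a b : continuous f ->
  (@lebesgue_measure R).-integrable `[a, b] (EFin \o f).
Proof.
move=> cf; apply: continuous_compact_integrable.
  exact: segment_compact.
exact: continuous_subspaceT.
Qed.

Lemma RintegralZZD f g a b (c d : R) : continuous f -> continuous g ->
  Rintegral (@lebesgue_measure R) `[a, b] (fun x => c * f x + d * g x) =
  c * Rintegral (@lebesgue_measure R) `[a, b] f
  + d * Rintegral (@lebesgue_measure R) `[a, b] g.
Proof.
move=> cf cg; rewrite RintegralD//=.
- by rewrite !RintegralZl//; exact: continuous_integrable.
- by apply: continuous_integrable => x; apply: cvgM (cf x); exact: cvg_cst.
- by apply: continuous_integrable => x; apply: cvgM (cg x); exact: cvg_cst.
Qed.

Lemma cintegralZ a b (c : R[i]) h : ccontinuous h ->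
  cintegral a b (fun x => c * h x) = c * cintegral a b h.
Proof.
case: c => c d [hr hi]; rewrite /cintegral.
have -> : (fun x => complex.Re ((c +i* d) * h x))
    = (fun x => c * complex.Re (h x) + (- d) * complex.Im (h x)).
  by apply/funext => x; case: (h x) => u v /=; rewrite mulNr.
have -> : (fun x => complex.Im ((c +i* d) * h x))
    = (fun x => c * complex.Im (h x) + d * complex.Re (h x)).
  by apply/funext => x; case: (h x) => u v /=; rewrite addrC.
by rewrite !RintegralZZD//; simpc; congr (_ +i* _); ring.
Qed.

Lemma cintegralD a b h1 h2 : ccontinuous h1 -> ccontinuous h2 ->
  cintegral a b (fun x => h1 x + h2 x) = cintegral a b h1 + cintegral a b h2.
Proof.
move=> [r1 i1] [r2 i2]; rewrite /cintegral.
have -> : (fun x => complex.Re (h1 x + h2 x))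
    = (fun x => 1 * complex.Re (h1 x) + 1 * complex.Re (h2 x)).
  by apply/funext => x; case: (h1 x) => u v; case: (h2 x) => u' v' /=; rewrite !mul1r.
have -> : (fun x => complex.Im (h1 x + h2 x))
    = (fun x => 1 * complex.Im (h1 x) + 1 * complex.Im (h2 x)).
  by apply/funext => x; case: (h1 x) => u v; case: (h2 x) => u' v' /=; rewrite !mul1r.
by rewrite !RintegralZZD// !mul1r.
Qed.

Lemma ccontinuousZ (c : R[i]) h : ccontinuous h -> ccontinuous (fun x => c * h x).
Proof.
case: c => c d [hr hi]; split => x.
  rewrite (_ : (fun x => complex.Re ((c +i* d) * h x))
    = (fun x => c * complex.Re (h x) - d * complex.Im (h x))).
    by apply: cvgB; (apply: cvgM; [exact: cvg_cst|]); [exact: hr|exact: hi].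
  by apply/funext => y; case: (h y) => u v.
rewrite (_ : (fun x => complex.Im ((c +i* d) * h x))
    = (fun x => c * complex.Im (h x) + d * complex.Re (h x))).
  by apply: cvgD; (apply: cvgM; [exact: cvg_cst|]); [exact: hi|exact: hr].
by apply/funext => y; case: (h y) => u v; rewrite /= addrC.
Qed.

Lemma ccontinuousD h1 h2 : ccontinuous h1 -> ccontinuous h2 ->
  ccontinuous (fun x => h1 x + h2 x).
Proof.
move=> [r1 i1] [r2 i2]; split => x.
  rewrite (_ : (fun x => _) = (fun x => complex.Re (h1 x) + complex.Re (h2 x))).
    by apply: cvgD; [exact: r1|exact: r2].
  by apply/funext => y; case: (h1 y) => u v; case: (h2 y).
rewrite (_ : (fun x => _) = (fun x => complex.Im (h1 x) + complex.Im (h2 x))).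
  by apply: cvgD; [exact: i1|exact: i2].
by apply/funext => y; case: (h1 y) => u v; case: (h2 y).
Qed.

Lemma ccontinuous_cst (c : R[i]) : ccontinuous (fun=> c).
Proof. by split=> x; exact: cvg_cst. Qed.

Lemma cintegral0 a b : cintegral a b (fun=> 0 : R[i]) = 0.
Proof. by rewrite /cintegral /Rintegral !integral0. Qed.

Lemma ccontinuous_sum (J : Type) (s : seq J) (c : J -> R[i]) (h : J -> R -> R[i]) :
  (forall j, ccontinuous (h j)) -> ccontinuous (fun x => \sum_(j <- s) c j * h j x).
Proof.
move=> ch; elim: s => [|j s IH].
  by under eq_fun do rewrite big_nil; exact: ccontinuous_cst.
under eq_fun do rewrite big_cons.
by apply: ccontinuousD => //; exact: ccontinuousZ.
Qed.

Lemma cintegral_sum (J : Type) (s : seq J) (c : J -> R[i]) (h : J -> R -> R[i]) a b :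
  (forall j, ccontinuous (h j)) ->
  cintegral a b (fun x => \sum_(j <- s) c j * h j x)
  = \sum_(j <- s) c j * cintegral a b (h j).
Proof.
move=> ch; elim: s => [|j s IH].
  by under eq_fun do rewrite big_nil; rewrite cintegral0 big_nil.
under eq_fun do rewrite big_cons.
rewrite cintegralD ?cintegralZ ?IH ?big_cons//.
  exact: ccontinuousZ.
exact: ccontinuous_sum.
Qed.

Lemma expiD a b : expi (a + b) = expi a * expi b.
Proof. by rewrite /expi cosD sinD; simpc; congr (_ +i* _); ring. Qed.

Lemma expi0 : expi 0 = 1 :> R[i].
Proof. by rewrite /expi cos0 sin0. Qed.

Lemma expi_neq0 a : expi a != 0.
Proof.
apply/eqP => e; have := expiD a (- a).
by rewrite subrr expi0 e mul0r => /eqP; rewrite oner_eq0.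
Qed.

Lemma expiN a : expi (- a) = (expi a)^-1.
Proof. by apply: (mulIf (expi_neq0 a)); rewrite mulVf ?expi_neq0// -expiD addNr expi0. Qed.

Lemma expiXz a (n : int) : expi a ^ n = expi (n%:~R * a).
Proof.
have X (k : nat) : expi a ^+ k = expi (k%:R * a).
  by elim: k => [|k IH]; rewrite ?mul0r ?expi0// exprS IH -expiD -natr1; congr expi; ring.
case: n => n; first by rewrite -exprnP X.
by rewrite NegzE -exprnN X -expiN; congr expi; rewrite mulrNz mulNr.
Qed.

Lemma expi2pi : expi (2 * pi) = 1 :> R[i].
Proof. by rewrite /expi mulr_natl cos2pi sin2pi. Qed.

Lemma continuous_cosM (k : R) : continuous (fun x => cos (k * x)).
Proof.
move=> x; apply: continuous_comp; last exact: continuous_cos.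
by apply: cvgM; [exact: cvg_cst|exact: cvg_id].
Qed.

Lemma continuous_sinM (k : R) : continuous (fun x => sin (k * x)).
Proof.
move=> x; apply: continuous_comp; last exact: continuous_sin.
by apply: cvgM; [exact: cvg_cst|exact: cvg_id].
Qed.

Lemma ccontinuous_expiXz (n : int) : ccontinuous (fun x => expi x ^ n).
Proof.
under eq_fun do rewrite expiXz; split; [exact: continuous_cosM|exact: continuous_sinM].
Qed.

Lemma cintegral_expiXz (n : int) : n != 0 ->
  cintegral 0 (2 * pi) (fun x : R => expi x ^ n) = 0.
Proof.
move=> n0; under eq_fun do rewrite expiXz; set k : R := n%:~R.
have k0 : k != 0 by rewrite intr_eq0.
have p0 : (0 : R) < 2 * pi by rewrite mulr_gt0 ?pi_gt0.
have [c1 s1] : cos (k * (2 * pi)) = 1 /\ sin (k * (2 * pi)) = 0.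
  by have := expiXz (2 * pi) n; rewrite expi2pi exp1rz => /eqP;
    rewrite eq_complex => /andP[/eqP /= <- /eqP /= <-].
have dS x : is_derive x (1 : R) (fun x => k^-1 * sin (k * x)) (cos (k * x)).
  apply: is_derive_eq.
  by rewrite /GRing.scale /=; field.
have dC x : is_derive x (1 : R) (fun x => - k^-1 * cos (k * x)) (sin (k * x)).
  apply: is_derive_eq.
  by rewrite /GRing.scale /=; field.
rewrite /cintegral (Rintegral_deriv p0 (@continuous_cosM k) dS).
rewrite (Rintegral_deriv p0 (@continuous_sinM k) dC).
by rewrite c1 s1 !mulr0 cos0 sin0 mulr0 !subrr.
Qed.

Lemma ccontinuous_RtoC f : continuous f -> ccontinuous (fun x => (f x)%:C).
Proof. by move=> cf; split=> //= x; exact: cvg_cst. Qed.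

Lemma continuous_sin_horner_cos (u : {poly R}) :
  continuous (fun x => sin x * u.[cos x]).
Proof.
move=> x; apply: cvgM; first exact: continuous_sin.
apply: continuous_comp; first exact: continuous_cos.
exact: continuous_horner.
Qed.

(** Substitution x = cos(theta): if P' = u, then - P(cos(theta)) is an antiderivative of the
    integrand. *)
Lemma cintegral_zero_mean (u : {poly R}) : zero_mean u ->
  cintegral 0 pi (fun x : R => (sin x * u.[cos x])%:C) = 0.
Proof.
move=> [P dP eP]; rewrite /cintegral /=.
have dP' x : is_derive x (1 : R) (fun x => - P.[cos x]) (sin x * u.[cos x]).
  have := @is_derive1_comp _ (horner P) cos x _ _ (is_derive_poly P (cos x))
    (is_derive_cos x).
  move=> h; apply: is_derive_eq.
  by rewrite dP; ring.
rewrite (Rintegral_deriv (pi_gt0 R) (@continuous_sin_horner_cos u) dP').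
by rewrite cospi cos0 eP subrr /Rintegral integral0.
Qed.

End Integrals.

(** * The volume form *)

Section Frame.
Local Open Scope classical_set_scope.
Local Open Scope complex_scope.
Variable R : realType.
Implicit Types (a x theta phi : R) (h : R -> R[i]).

Definition is_cderive h x (d : R[i]) :=
  is_derive x (1 : R) (fun y => complex.Re (h y)) (complex.Re d) /\
  is_derive x (1 : R) (fun y => complex.Im (h y)) (complex.Im d).

Lemma cderiveE h x d : is_cderive h x d -> cderive h x = d.
Proof.
by move=> [dr di]; rewrite /cderive !derive1E !derive_val; case: d {dr di}.
Qed.

Lemma is_cderiveM (c : R[i]) h x d : is_cderive h x d ->
  is_cderive (fun y => c * h y) x (c * d).
Proof.
case: c => c1 c2; case: d => d1 d2 [dr di]; split.
  rewrite (_ : (fun y => _) = (fun y => c1 * complex.Re (h y) - c2 * complex.Im (h y))).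
    by apply: is_derive_eq.
  by apply/funext => y; case: (h y).
rewrite (_ : (fun y => _) = (fun y => c1 * complex.Im (h y) + c2 * complex.Re (h y))).
  apply: is_derive_eq.
  by rewrite /GRing.scale /=.
by apply/funext => y; case: (h y).
Qed.

Lemma is_cderive_cst (c : R[i]) x : is_cderive (fun=> c) x 0.
Proof. by split; exact: is_derive_cst. Qed.

Lemma is_cderive_expi x : is_cderive (@expi R) x ('i * expi x).
Proof.
rewrite -complexiE /expi; split; simpc => /=.
  by apply: is_derive_eq; rewrite ?mul0r ?mul1r ?sub0r.
by apply: is_derive_eq; rewrite ?mul0r ?mul1r ?add0r.
Qed.

Lemma is_cderive_expiN x : is_cderive (fun y => expi (- y)) x (- 'i * expi (- x)).
Proof.
rewrite -complexiE /expi; split; simpc => /=.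
  rewrite (_ : (fun y => cos (- y)) = cos); last by apply/funext => y; rewrite cosN.
  by apply: is_derive_eq; rewrite sinN.
rewrite (_ : (fun y => sin (- y)) = (fun y => - sin y)); last by apply/funext => y; rewrite sinN.
by apply: is_derive_eq; rewrite cosN.
Qed.

Lemma is_cderive_RtoC (f : R -> R) x d : is_derive x (1 : R) f d ->
  is_cderive (fun y => (f y)%:C) x d%:C.
Proof. by move=> fd; split => //=; exact: is_derive_cst. Qed.

Lemma conjc_expi x : (expi x)^* = expi (- x).
Proof. by rewrite /expi cosN sinN. Qed.

Lemma GamE a theta phi : Gam a theta phi =
  mx2 (expi a * ((sin theta)%:C * expi phi)) (expi a * ('i * (cos theta)%:C))
    (expi a * ('i * (cos theta)%:C)) (expi a * ((sin theta)%:C * expi (- phi))).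
Proof.
rewrite -conjc_expi; apply/matrixP => u v; rewrite !mxE rmorphM /=.
by case: (u == 0); case: (v == 0) => //; congr (_ * (_ * _)); rewrite /expi; simpc.
Qed.

Lemma mxderive_mx2 (h1 h2 h3 h4 : R -> R[i]) x d1 d2 d3 d4 :
  is_cderive h1 x d1 -> is_cderive h2 x d2 -> is_cderive h3 x d3 ->
  is_cderive h4 x d4 ->
  mxderive (fun y => mx2 (h1 y) (h2 y) (h3 y) (h4 y)) x = mx2 d1 d2 d3 d4.
Proof.
move=> D1 D2 D3 D4; apply/matrixP => u v; rewrite !mxE; apply: cderiveE.
rewrite (_ : (fun y => _) = if u == 0 then (if v == 0 then h1 else h2) else
  (if v == 0 then h3 else h4)).
  by case: (u == 0); case: (v == 0).
by apply/funext => y; rewrite mxE; case: (u == 0); case: (v == 0).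
Qed.

Lemma det3E (A : 'M[R[i]]_3) : \det A =
  A 0 0 * (A 1 1 * A ord_max ord_max - A 1 ord_max * A ord_max 1)
  - A 0 1 * (A 1 0 * A ord_max ord_max - A 1 ord_max * A ord_max 0)
  + A 0 ord_max * (A 1 0 * A ord_max 1 - A 1 1 * A ord_max 0).
Proof.
rewrite (expand_det_row _ 0) !big_ord_recl big_ord0 /cofactor !det2E !mxE /=.
rewrite !(expr0, expr1, exprS, mul1r, mulN1r, mulrN, addr0, opprK) /=.
rewrite addrA.
by congr (_ * (A _ _ * A _ _ - A _ _ * A _ _) - _ * (A _ _ * A _ _ - A _ _ * A _ _)
  + _ * (A _ _ * A _ _ - A _ _ * A _ _)); do ?[congr (A _ _)]; apply/val_inj.
Qed.

Lemma zcoord_mx2 (c p q r t : R[i]) :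
  [/\ zcoord (c *: mx2 p q r t) 0 = c * ((p + t) / 2),
      zcoord (c *: mx2 p q r t) 1 = c * ('i * q) &
      zcoord (c *: mx2 p q r t) ord_max = c * ((t - p) / (2 * 'i))].
Proof.
rewrite /zcoord; split; rewrite (tnth_nth 0) /= !mxE /=.
- by rewrite -mulrDr mulrA.
- by rewrite mulrCA.
- by rewrite -mulrBr mulrA.
Qed.

Lemma dZ3E (v : 'I_3 -> 'M[R[i]]_2) (c0 c1 c2 p0 p1 p2 q0 q1 q2 r0 r1 r2 t0 t1 t2 : R[i]) :
  v 0 = c0 *: mx2 p0 q0 r0 t0 -> v 1 = c1 *: mx2 p1 q1 r1 t1 ->
  v ord_max = c2 *: mx2 p2 q2 r2 t2 ->
  dZ3 v = c0 * c1 * c2 * ((p0 + t0) / 2 * ('i * q1 * ((t2 - p2) / (2 * 'i))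
      - 'i * q2 * ((t1 - p1) / (2 * 'i)))
    - (p1 + t1) / 2 * ('i * q0 * ((t2 - p2) / (2 * 'i))
      - 'i * q2 * ((t0 - p0) / (2 * 'i)))
    + (p2 + t2) / 2 * ('i * q0 * ((t1 - p1) / (2 * 'i))
      - 'i * q1 * ((t0 - p0) / (2 * 'i)))).
Proof.
move=> e0 e1 e2; rewrite /dZ3; set A := \matrix_(_, _) _.
have E j k : A j k = zcoord (v k) j by rewrite mxE.
rewrite det3E (E 0 0) (E 0 1) (E 0 ord_max) (E 1 0) (E 1 1) (E 1 ord_max).
rewrite (E ord_max 0) (E ord_max 1) (E ord_max ord_max) e0 e1 e2.
have [-> -> ->] := zcoord_mx2 c0 p0 q0 r0 t0.
have [-> -> ->] := zcoord_mx2 c1 p1 q1 r1 t1.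
have [-> -> ->] := zcoord_mx2 c2 p2 q2 r2 t2.
by ring.
Qed.

(** Each of the three frame vectors carries one factor zeta = e^(i a), hence the cube; the remaining
    determinant gives the area element of the sphere. *)
Lemma dZ3_Gam a theta phi :
  dZ3 (Gam_frame a theta phi) = - 'i * (sin theta)%:C * expi a ^+ 3.
Proof.
have Fa : Gam_frame a theta phi 0 = 'i *: Gam a theta phi.
  rewrite /Gam_frame (tnth_nth 0) /=; under eq_fun do rewrite GamE.
  rewrite (_ : (fun x => _) = fun x => mx2 ((sin theta)%:C * expi phi * expi x)
    ('i * (cos theta)%:C * expi x) ('i * (cos theta)%:C * expi x)
    ((sin theta)%:C * expi (- phi) * expi x)); last first.
    by apply/funext => x; congr mx2; rewrite mulrC.
  rewrite (mxderive_mx2 (is_cderiveM _ (is_cderive_expi a))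
    (is_cderiveM _ (is_cderive_expi a)) (is_cderiveM _ (is_cderive_expi a))
    (is_cderiveM _ (is_cderive_expi a))) GamE.
  by apply/matrixP => u v; rewrite !mxE; case: (u == 0); case: (v == 0); ring.
have Ft : Gam_frame a theta phi 1 = expi a *: mx2 ((cos theta)%:C * expi phi)
    (- 'i * (sin theta)%:C) (- 'i * (sin theta)%:C) ((cos theta)%:C * expi (- phi)).
  rewrite /Gam_frame (tnth_nth 0) /=; under eq_fun do rewrite GamE.
  rewrite (_ : (fun x => _) = fun x => mx2 ((expi a * expi phi) * (sin x)%:C)
    ((expi a * 'i) * (cos x)%:C) ((expi a * 'i) * (cos x)%:C)
    ((expi a * expi (- phi)) * (sin x)%:C)); last first.
    by apply/funext => x; congr mx2; ring.
  rewrite (mxderive_mx2 (is_cderiveM _ (is_cderive_RtoC (is_derive_sin theta)))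
    (is_cderiveM _ (is_cderive_RtoC (is_derive_cos theta)))
    (is_cderiveM _ (is_cderive_RtoC (is_derive_cos theta)))
    (is_cderiveM _ (is_cderive_RtoC (is_derive_sin theta)))).
  by apply/matrixP => u v; rewrite !mxE rmorphN; case: (u == 0); case: (v == 0); ring.
have Fp : Gam_frame a theta phi ord_max = expi a *: mx2 ('i * (sin theta)%:C * expi phi)
    0 0 (- 'i * (sin theta)%:C * expi (- phi)).
  rewrite /Gam_frame (tnth_nth 0) /=; under eq_fun do rewrite GamE.
  rewrite (_ : (fun x => _) = fun x => mx2 ((expi a * (sin theta)%:C) * expi x)
    (expi a * ('i * (cos theta)%:C)) (expi a * ('i * (cos theta)%:C))
    ((expi a * (sin theta)%:C) * expi (- x))); last first.
    by apply/funext => x; congr mx2; ring.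
  rewrite (mxderive_mx2 (is_cderiveM _ (is_cderive_expi phi))
    (is_cderive_cst _ _) (is_cderive_cst _ _) (is_cderiveM _ (is_cderive_expiN phi))).
  by apply/matrixP => u v; rewrite !mxE; case: (u == 0); case: (v == 0); ring.
rewrite GamE in Fa; rewrite (dZ3E Fa Ft Fp).
have i0 : 'i != 0 :> R[i] by rewrite neq0Ci.
have e1 : expi phi * expi (- phi) = 1 by rewrite -expiD subrr expi0.
have e2 : (sin theta)%:C ^+ 2 + (cos theta)%:C ^+ 2 = 1.
  by rewrite -!rmorphXn -rmorphD /= addrC cos2Dsin2.
have e3 : 'i ^+ 2 = -1 :> R[i] by exact: sqrCi.
move: e1 e2 e3 i0; move: (expi phi) (expi (- phi)) (cos theta)%:C (sin theta)%:C
  (expi a) => E F c s z e1 e2 e3 i0.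
(* The determinant is grouped into factors that [e1], [e2] and [e3] turn into constants. *)
transitivity ('i * z ^+ 3 * ('i ^+ 2 * s * (s ^+ 2 + c ^+ 2) * (E * F))).
  by field.
by rewrite e1 e2 e3; ring.
Qed.

End Frame.

(** * Integrands of zero integral *)

Section Null.
Local Open Scope classical_set_scope.
Local Open Scope complex_scope.
Variable R : realType.
Implicit Types (a theta phi : R) (H : R -> R -> R -> R[i]).

Definition zpt theta phi : R[i] := (sin theta)%:C * expi phi.

(* The monomial c zeta^k z^j u(t) at zeta = e^(i a) and the point (z, t) of the
   unit sphere; its integral vanishes when null_mono holds. *)
Definition mono_val (w : R[i] * int * int * {poly R}) a theta phi : R[i] :=
  let: (c, k, j, u) := w in
  c * expi a ^ k * zpt theta phi ^ j * (u.[cos theta])%:C.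

(** The alternatives make the integral over phi, over a and over theta vanish, respectively; the 3
    comes from the factor zeta^3 of dZ^3. *)
Definition null_mono (w : R[i] * int * int * {poly R}) : Prop :=
  let: (c, k, j, u) := w in j != 0 \/ (k + 3 != 0 \/ zero_mean u).

(** The poles of the sphere are excluded because the monomials may contain negative powers of z. *)
Definition null_fun H := exists s : seq (R[i] * int * int * {poly R}),
  (forall w, w \in s -> null_mono w) /\
  forall a theta phi, sin theta != 0 ->
    H a theta phi = \sum_(w <- s) mono_val w a theta phi.

Lemma null_fun_ext H1 H2 : null_fun H1 ->
  (forall a theta phi, sin theta != 0 -> H2 a theta phi = H1 a theta phi) ->
  null_fun H2.
Proof.
by move=> [s [s0 sE]] e; exists s; split=> // a t p t0; rewrite e// sE.
Qed.

Lemma null_fun0 : null_fun (fun _ _ _ => 0).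
Proof. by exists [::]; split=> // a t p _; rewrite big_nil. Qed.

Lemma null_funD H1 H2 : null_fun H1 -> null_fun H2 ->
  null_fun (fun a t p => H1 a t p + H2 a t p).
Proof.
move=> [s1 [n1 e1]] [s2 [n2 e2]]; exists (s1 ++ s2); split=> [w|a t p t0].
  by rewrite mem_cat => /orP[/n1|/n2].
by rewrite big_cat /= e1// e2.
Qed.

Lemma null_funZ (c : R[i]) H : null_fun H -> null_fun (fun a t p => c * H a t p).
Proof.
move=> [s [n e]]; exists [seq let: (d, k, j, u) := w in (c * d, k, j, u) | w <- s].
split=> [w /mapP[[[[d k] j] u]] /n dn ->//|a t p t0].
rewrite big_map e// mulr_sumr; apply: eq_bigr => -[[[d k] j] u] _ /=.
by rewrite !mulrA.
Qed.

Lemma null_fun_sum (J : eqType) (s : seq J) (H : J -> R -> R -> R -> R[i]) :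
  (forall j, j \in s -> null_fun (H j)) ->
  null_fun (fun a t p => \sum_(j <- s) H j a t p).
Proof.
elim: s => [|j s IH] nH.
  by apply: (null_fun_ext null_fun0) => a t p _; rewrite big_nil.
apply: (null_fun_ext (null_funD (nH j _) (IH _))); first exact: mem_head.
  by move=> k ks; apply: nH; rewrite inE ks orbT.
by move=> a t p _; rewrite big_cons.
Qed.

Lemma null_fun_mono (c : R[i]) (k j : int) (u : {poly R}) : null_mono (c, k, j, u) ->
  null_fun (fun a t p => c * expi a ^ k * zpt t p ^ j * (u.[cos t])%:C).
Proof.
move=> n; exists [:: (c, k, j, u)]; split=> [w|a t p _].
  by rewrite inE => /eqP ->.
by rewrite big_seq1.
Qed.

(** The variables phi, theta and a are integrated out in turn; after each step a finite sum of
    scalars times explicit continuous functions remains. *)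
Lemma Gam_integral_null (h : 'M[R[i]]_2 -> R[i] -> R[i]) :
  null_fun (fun a t p => h (Gam a t p) (expi a)) -> Gam_integral h = 0.
Proof.
move=> [s [ns hE]]; rewrite /Gam_integral.
pose K (j : int) : R[i] := cintegral 0 (2 * pi) (fun p : R => expi p ^ j).
pose L (u : {poly R}) : R[i] := cintegral 0 pi (fun t => (sin t * u.[cos t])%:C).
have inner a t : cintegral 0 (2 * pi) (fun p =>
      h (Gam a t p) (expi a) * dZ3 (Gam_frame a t p))
    = \sum_(w <- s) (- 'i * w.1.1.1 * K w.1.2 * expi a ^ (w.1.1.2 + 3))
        * (sin t * w.2.[cos t])%:C.
  under eq_fun do rewrite dZ3_Gam.
  have [t0|t0] := eqVneq (sin t) 0.
    rewrite t0 rmorph0; under eq_fun do rewrite mulr0 mul0r mulr0.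
    by rewrite cintegral0 big1// => w _; rewrite mul0r rmorph0 mulr0.
  under eq_fun do rewrite hE// mulr_suml.
  rewrite (_ : (fun p => _) = fun p => \sum_(w <- s)
    (- 'i * w.1.1.1 * (sin t)%:C ^ w.1.2 * expi a ^ (w.1.1.2 + 3)
      * (sin t * w.2.[cos t])%:C) * expi p ^ w.1.2); last first.
    apply/funext => p; apply: eq_bigr => -[[[c k] j] u] _ /=.
    rewrite /zpt exprzMl ?unitfE ?fmorph_eq0 ?expi_neq0//.
    rewrite expfzDr ?expi_neq0// rmorphM /= -[expi a ^+ 3]/(expi a ^ 3).
    by move: (expi a ^ k) (expi a ^ 3) (expi p ^ j) (_%:C ^ j) => x y z v; ring.
  rewrite cintegral_sum; last by move=> w; exact: ccontinuous_expiXz.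
  apply: eq_bigr => -[[[c k] j] u] _ /=; rewrite -/(K j).
  (* Only j = 0 survives the integral over phi, and then the power of sin(theta) coming from z^j is
     1. *)
  have [->|j0] := eqVneq j 0; first by rewrite expr0z; ring.
  by rewrite (_ : K j = 0) ?mulr0 ?mul0r//; exact: cintegral_expiXz.
have middle a : cintegral 0 pi (fun t => cintegral 0 (2 * pi) (fun p =>
      h (Gam a t p) (expi a) * dZ3 (Gam_frame a t p)))
    = \sum_(w <- s) (- 'i * w.1.1.1 * K w.1.2 * L w.2) * expi a ^ (w.1.1.2 + 3).
  under eq_fun do rewrite inner.
  rewrite cintegral_sum.
    by apply: eq_bigr => w _; rewrite -/(L w.2) mulrAC.
  by move=> w; apply: ccontinuous_RtoC; exact: continuous_sin_horner_cos.
under eq_fun do rewrite middle.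
rewrite cintegral_sum; last by move=> w; exact: ccontinuous_expiXz.
rewrite big_seq big1// => -[[[c k] j] u] /ns /= [j0|[k0|u0]].
- by rewrite (_ : K j = 0) ?mulr0 ?mul0r//; exact: cintegral_expiXz.
- by rewrite cintegral_expiXz ?mulr0.
- by rewrite (_ : L u = 0) ?mulr0 ?mul0r//; exact: cintegral_zero_mean.
Qed.

End Null.

(** * Solid harmonics and polynomials on the cycle *)

Section Sphere.
Local Open Scope classical_set_scope.
Local Open Scope complex_scope.
Variable R : realType.
Implicit Types (a t p : R) (q : mpoly 3 R[i]) (Z : 'M[R[i]]_2).

Definition zptc t p : R[i] := (sin t)%:C * expi (- p).

Lemma zpt_neq0 t p : sin t != 0 -> zpt t p != 0.
Proof. by move=> t0; rewrite mulf_neq0 ?expi_neq0// fmorph_eq0. Qed.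

Lemma zpt_mul t p : zpt t p * zptc t p = (1 - cos t ^+ 2)%:C.
Proof.
rewrite /zpt /zptc mulrACA -expiD subrr expi0 mulr1 -rmorphM /= -expr2.
by rewrite -sin2cos2.
Qed.

(** Eliminates conj(z), so that integrands become sums of powers of z times polynomials in
    cos(theta), as in [mono_val]. *)
Lemma zptc_eq t p : sin t != 0 -> zptc t p = (1 - cos t ^+ 2)%:C * (zpt t p)^-1.
Proof. by move=> t0; rewrite -(zpt_mul t p) mulrAC mulfV ?mul1r// zpt_neq0. Qed.

Lemma norm_expi p : `|expi p| = 1.
Proof. by rewrite /expi normc_def /= cos2Dsin2 sqrtr1. Qed.

(** Restriction of R^m_l to the unit sphere. The degree is an integer so that the contiguity
    relations may refer to l - 1 at l = 0, where the value is 0. *)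
Definition sharm (l m : int) t p : R[i] :=
  zpt t p ^ m * ((alegendre R l m).[cos t])%:C.

Lemma conjc_zpt t p : (zpt t p)^* = zptc t p.
Proof. by rewrite /zpt /zptc -conjc_expi rmorphM /=; congr (_ * _); simpc. Qed.

Lemma peval0 Z : peval 0 Z = 0.
Proof. exact: meval0. Qed.

Lemma coords_sphere t p :
  coords (sphere_pt t p) = tnth [tuple zpt t p; (zpt t p)^*; (cos t)%:C].
Proof.
apply/funext => i; rewrite /coords !(tnth_nth 0) /= !mxE /=.
by rewrite mulrA mulNr -expr2 sqrCi opprK mul1r.
Qed.

Lemma RR_sphere (l : nat) (m : int) t p : sin t != 0 ->
  RR l m (sphere_pt t p) = sharm l m t p.
Proof.
move=> t0; rewrite /RR; have [ml|ml] := boolP (`|m| <= l)%N; last first.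
  rewrite /solid_harmonic (negbTE ml) peval0 /sharm alegendre_out ?horner0 ?mulr0//.
  by lia.
have [_ H] := solid_harmonicP R ml.
have := H (zpt t p) (cos t) (zpt_neq0 p t0); rewrite -coords_sphere => H'.
rewrite /peval H' {H H'} /=.
have -> : complex.Re (zpt t p) ^+ 2 + complex.Im (zpt t p) ^+ 2 = sin t ^+ 2.
  rewrite /zpt /expi; simpc => /=; rewrite !exprMn -mulrDr cos2Dsin2 mulr1.
  by [].
rewrite addrC cos2Dsin2 sqrtr1 expr1n divr1 mul1r.
(* The sine may be negative here. The factor (1 - t^2)^(m/2) of the Legendre function is the m-th
   power of its absolute value, which cancels the denominator of (z / |z|)^m. *)
have nz : `|zpt t p| = (`|sin t|)%:C.
  rewrite /zpt normrM norm_expi mulr1 normc_def /= expr0n /= addr0.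
  by rewrite sqrtr_sqr.
have n0 : (`|sin t|)%:C != 0 :> R[i] by rewrite fmorph_eq0 normr_eq0.
have -> : legendre l m (cos t) = `|sin t| ^ m * (alegendre R l m).[cos t].
  rewrite /legendre -sin2cos2 /alegendre hornerZ.
  have -> : (sin t ^+ 2) `^ (m%:~R / 2) = `|sin t| ^ m.
    rewrite -real_normK ?num_real// -powR_mulrn// -powRrM mulrCA divff ?pnatr_eq0//.
    by rewrite mulr1 powR_intmul.
  have -> : drod R (l%:Z + m) l
      = (2 ^+ l * l`!%:R)^-1 *: (('X ^+ 2 - 1) ^+ l)^`(absz (l%:Z + m)).
    rewrite -derivnZ; have : 0 <= l%:Z + m by lia.
    by case: (l%:Z + m).
  by rewrite hornerZ; ring.
have key : (zpt t p / `|zpt t p|) ^ m * (`|sin t| ^ m)%:C = zpt t p ^ m.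
  rewrite nz rmorphXz ?unitfE ?normr_eq0//=.
  move: n0 (zpt_neq0 p t0); move: (zpt t p) (`|sin t|%:C) => z s s0 z0.
  by rewrite -expfzMl mulfVK.
by rewrite rmorphM /= mulrA key.
Qed.

Lemma pevalM q1 q2 Z : peval (q1 * q2) Z = peval q1 Z * peval q2 Z.
Proof. exact: mevalM. Qed.

Lemma pevalE q Z : peval q Z = \sum_(mm <- msupp q) mcoeff mm q *
  (coords Z 0 ^+ mm 0 * coords Z 1 ^+ mm 1 * coords Z ord_max ^+ mm ord_max).
Proof.
rewrite /peval mevalE; apply: eq_bigr => mm _; congr (_ * _).
rewrite !big_ord_recl big_ord0 mulr1 mulrA.
by congr (_ ^+ _ * _ ^+ _ * _ ^+ _); do ?[congr (_ _ _)|congr (coords _ _)]; apply/val_inj.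
Qed.

Lemma mdeg3 (mm : multinom 3) : mdeg mm = (mm 0%R + mm 1%R + mm ord_max)%N.
Proof.
rewrite mdegE !big_ord_recl big_ord0 addn0 addnA.
by congr (_ + _ + _)%N; congr (_ _ _); apply/val_inj.
Qed.

Lemma coordsZ (c : R[i]) Z i : coords (c *: Z) i = c * coords Z i.
Proof.
rewrite /coords !(tnth_nth 0); case: i => -[|[|[|//]]] ?; rewrite /= !mxE//.
by rewrite mulrCA.
Qed.

Lemma peval_homog (d : nat) q (c : R[i]) Z : q \is ishomog1 d mdeg ->
  peval q (c *: Z) = c ^+ d * peval q Z.
Proof.
move=> /dhomogP hq; rewrite !pevalE mulr_sumr; apply: eq_big_seq => mm /hq md.
rewrite !coordsZ !exprMn.
have -> : c ^+ d = c ^+ mm 0 * c ^+ mm 1 * c ^+ mm ord_max.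
  by rewrite -!exprD -mdeg3 md.
move: (c ^+ mm 0) (c ^+ mm 1) (c ^+ mm ord_max)
  (_ ^+ mm 0) (_ ^+ mm 1) (_ ^+ mm ord_max) => x y z x' y' z'.
by ring.
Qed.

Lemma RR_Gam (l : nat) (m : int) a t p : sin t != 0 ->
  RR l m (Gam a t p) = expi a ^ l * sharm l m t p.
Proof.
move=> t0; rewrite -RR_sphere// /RR /Gam; apply: peval_homog.
have [ml|ml] := boolP (`|m| <= l)%N; first by case: (solid_harmonicP R ml).
by rewrite /solid_harmonic (negbTE ml) rpred0.
Qed.

(** The degree bound is required only when the exponent of zeta is -3; otherwise the integral over a
    already vanishes. *)
Lemma null_mono_sharm (b c e l : nat) (m k : int) :
  (k + 3 = 0 -> (b + c + e < l)%N) ->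
  null_fun (fun a t p => expi a ^ k *
    (zpt t p ^+ b * zptc t p ^+ c * (cos t)%:C ^+ e) * sharm l m t p).
Proof.
move=> kl; pose u := (1 - 'X ^+ 2) ^+ c * 'X ^+ e * alegendre R l m.
have : null_mono (1, k, b%:Z + m - c%:Z, u).
  rewrite /=; have [j0|] := eqVneq (b%:Z + m - c%:Z) 0; last by left.
  right; have [k0|] := eqVneq (k + 3) 0; last by left.
  by right; apply: (@zero_mean_alegendre _ _ b); [lia|exact: kl].
move=> /null_fun_mono n; apply: (null_fun_ext n) => a t p t0.
have uE : (u.[cos t])%:C = (1 - cos t ^+ 2)%:C ^+ c * (cos t)%:C ^+ e
    * ((alegendre R l m).[cos t])%:C.
  rewrite /u hornerM rmorphM /=; congr (_ * _).
  by rewrite !hornerE rmorphM !rmorphXn.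
have z0 := zpt_neq0 p t0.
have zE : zpt t p ^ (b%:Z + m - c%:Z) = zpt t p ^+ b * zpt t p ^ m * (zpt t p)^-1 ^+ c.
  by rewrite !expfzDr// exprVn exprnN.
rewrite mul1r uE zE zptc_eq// /sharm [(_%:C / _) ^+ c]exprMn.
move: (expi a ^ k) (zpt t p ^+ b) (zpt t p ^ m) ((zpt t p)^-1 ^+ c) (_%:C ^+ c)
  ((cos t)%:C ^+ e) (_.[_]%:C) => x1 x2 x3 x4 x5 x6 x7.
by ring.
Qed.

(** The inverse of zeta X, written as zeta^(-1) adj X since det X = 1. *)
Definition Gam_inv a t p : 'M[R[i]]_2 :=
  expi (- a) *: mx2 (zptc t p) (- ('i * (cos t)%:C)) (- ('i * (cos t)%:C)) (zpt t p).

Lemma coords_Gam_inv a t p : [/\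
  coords (Gam_inv a t p) 0 = expi (- a) * zptc t p,
  coords (Gam_inv a t p) 1 = expi (- a) * zpt t p &
  coords (Gam_inv a t p) ord_max = expi (- a) * - (cos t)%:C].
Proof.
rewrite /Gam_inv !coordsZ /coords; split; rewrite (tnth_nth 0) /= !mxE //=.
by congr (_ * _); rewrite mulrNN mulrA -expr2 sqrCi mulN1r.
Qed.

Lemma coords_Gam a t p : [/\
  coords (Gam a t p) 0 = expi a * zpt t p,
  coords (Gam a t p) 1 = expi a * zptc t p &
  coords (Gam a t p) ord_max = expi a * (cos t)%:C].
Proof.
by rewrite /Gam !coordsZ coords_sphere -conjc_zpt; split; rewrite (tnth_nth 0).
Qed.

(** A monomial of degree d contributes zeta^d, so exponent -3 forces d = - k - 3 < l, and
    orthogonality applies. *)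
Lemma null_peval_Gam q (l : nat) (m k : int) : 0 < k + 3 + l%:Z ->
  null_fun (fun a t p => expi a ^ k * peval q (Gam a t p) * sharm l m t p).
Proof.
move=> kl; have n (mm : multinom 3) : null_fun (fun a t p => mcoeff mm q *
    (expi a ^ (k + (mdeg mm)%:Z) * (zpt t p ^+ mm 0 * zptc t p ^+ mm 1 *
      (cos t)%:C ^+ mm ord_max) * sharm l m t p)).
  apply/null_funZ/null_mono_sharm; rewrite -mdeg3; lia.
apply: (null_fun_ext (null_fun_sum (s := msupp q) (fun mm _ => n mm))) => a t p t0.
rewrite pevalE mulr_sumr mulr_suml; apply: eq_bigr => mm _.
have [-> -> ->] := coords_Gam a t p.
rewrite expfzDr ?expi_neq0// -[expi a ^ mdeg mm]/(expi a ^+ mdeg mm).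
rewrite mdeg3 !exprD.
move: (expi a ^ k) (expi a) (zpt t p) (zptc t p) (cos t)%:C (sharm l m t p)
  (mcoeff mm q) => y1 y2 y3 y4 y5 y6 y7.
rewrite !exprMn.
move: (y2 ^+ mm 0) (y2 ^+ mm 1) (y2 ^+ mm ord_max)
  (y3 ^+ _) (y4 ^+ _) (y5 ^+ _) => x1 x2 x3 x4 x5 x6.
by ring.
Qed.

(** At Z^(-1) a monomial of degree d contributes zeta^(-d), so exponent -3 forces d = k + 3 < l. The
    roles of z and conj(z) are exchanged and t changes sign. *)
Lemma null_peval_Gam_inv q (l : nat) (m k : int) : k + 3 < l%:Z ->
  null_fun (fun a t p => expi a ^ k * peval q (Gam_inv a t p) * sharm l m t p).
Proof.
move=> kl; have n (mm : multinom 3) : null_fun (fun a t p =>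
    mcoeff mm q * (-1) ^+ mm ord_max *
    (expi a ^ (k - (mdeg mm)%:Z) * (zpt t p ^+ mm 1 * zptc t p ^+ mm 0 *
      (cos t)%:C ^+ mm ord_max) * sharm l m t p)).
  apply/null_funZ/null_mono_sharm; have := mdeg3 mm; lia.
apply: (null_fun_ext (null_fun_sum (s := msupp q) (fun mm _ => n mm))) => a t p t0.
rewrite pevalE mulr_sumr mulr_suml; apply: eq_bigr => mm _.
have [-> -> ->] := coords_Gam_inv a t p.
rewrite expfzDr ?expi_neq0// -exprnN -exprVn -expiN.
rewrite mdeg3 !exprD.
move: (expi a ^ k) (expi (- a)) (zpt t p) (zptc t p) (cos t)%:C (sharm l m t p)
  (mcoeff mm q) => y1 y2 y3 y4 y5 y6 y7.
rewrite !exprMn [(- y5) ^+ _]exprNn.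
move: (y2 ^+ mm 0) (y2 ^+ mm 1) (y2 ^+ mm ord_max)
  (y3 ^+ _) (y4 ^+ _) (y5 ^+ _) (_ ^+ mm ord_max) => x1 x2 x3 x4 x5 x6 x7.
by ring.
Qed.

End Sphere.

(** * Products with the matrix harmonics *)

Section Trilinear.
Local Open Scope classical_set_scope.
Local Open Scope complex_scope.
Variable R : realType.
Implicit Types (a t p : R) (q : mpoly 3 R[i]) (Z : 'M[R[i]]_2) (k m : int) (l : nat).

Definition evalC (u : {poly R}) (x : R) : R[i] := (u.[x])%:C.

Lemma evalCZ (n : int) u x : evalC (n%:~R * u) x = n%:~R * evalC u x.
Proof.
by rewrite /evalC -[n%:~R](rmorph_int polyC) hornerCM rmorphM /= rmorph_int.
Qed.

Lemma evalCM u v x : evalC (u * v) x = evalC u x * evalC v x.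
Proof. by rewrite /evalC hornerM rmorphM. Qed.

Lemma evalCX x : evalC 'X x = x%:C.
Proof. by rewrite /evalC hornerX. Qed.

Lemma evalCD u v x : evalC (u + v) x = evalC u x + evalC v x.
Proof. by rewrite /evalC hornerD rmorphD. Qed.

Lemma evalCB u v x : evalC (u - v) x = evalC u x - evalC v x.
Proof. by rewrite /evalC hornerD hornerN rmorphB. Qed.

Lemma sharm_up (l m : int) t p : sin t != 0 -> 0 <= l -> - l <= m ->
  (2 * l + 1)%:~R * (zpt t p * sharm l m t p)
  = sharm (l - 1) (m + 1) t p - sharm (l + 1) (m + 1) t p.
Proof.
move=> t0 l0 lm; have := congr1 (evalC^~ (cos t)) (alegendre_up R l0 lm).
rewrite evalCZ evalCB => e.
rewrite /sharm expfzDr ?zpt_neq0// expr1z -mulrBr -!/(evalC _ _) -e.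
by move: (zpt t p ^ m) (zpt t p) (evalC _ _) => x y z; ring.
Qed.

Lemma sharm_cos (l m : int) t p : 0 <= l -> - l <= m ->
  (2 * l + 1)%:~R * ((cos t)%:C * sharm l m t p)
  = (l - m + 1)%:~R * sharm (l + 1) m t p + (l + m)%:~R * sharm (l - 1) m t p.
Proof.
move=> l0 lm; have := congr1 (evalC^~ (cos t)) (alegendreXM R l0 lm).
rewrite -mulrA evalCD !evalCZ evalCM evalCX => e.
rewrite /sharm -!/(evalC _ _) ![_ * (_ ^ m * _)]mulrCA -mulrDr -e.
by move: (zpt t p ^ m) (_%:C) (evalC _ _) => x y z; ring.
Qed.

Lemma sharm_down (l m : int) t p : sin t != 0 -> 0 <= l ->
  (2 * l + 1)%:~R * (zptc t p * sharm l m t p)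
  = ((l - m + 1) * (l - m + 2))%:~R * sharm (l + 1) (m - 1) t p
    - ((l + m - 1) * (l + m))%:~R * sharm (l - 1) (m - 1) t p.
Proof.
move=> t0 l0; have := congr1 (evalC^~ (cos t)) (alegendre_down R m l0).
rewrite -mulrA evalCB !evalCZ evalCM => e.
rewrite /sharm -!/(evalC _ _) ![_ * (_ ^ (m - 1) * _)]mulrCA -mulrBr -e.
rewrite (_ : zpt t p ^ m = zpt t p ^ (m - 1) * zpt t p); last first.
  by rewrite -[RHS]/(_ * zpt t p ^ 1) -expfzDr ?zpt_neq0// subrK.
rewrite (_ : evalC (1 - 'X ^+ 2) (cos t) = zpt t p * zptc t p); last first.
  by rewrite zpt_mul /evalC !hornerE.
by move: (zpt t p ^ (m - 1)) (zpt t p) (zptc t p) (evalC _ _) => x y z v; ring.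
Qed.

(* Cayley-Hamilton: X A X = tr(X A) X - det(X) adj(A). *)
Lemma sandwich (K : comNzRingType) (x w y a b c : K) :
  mx2 x w w y *m mx2 a b b c *m mx2 x w w y =
  (x * a + 2 * w * b + y * c) *: mx2 x w w y
  - (x * y - w ^+ 2) *: mx2 c (- b) (- b) a.
Proof.
apply/matrixP => i j; rewrite !mxE !big_ord_recl !big_ord0 !mxE /=.
rewrite !big_ord_recl !big_ord0 !mxE /=.
by case: i => -[|[|//]] ?; case: j => -[|[|//]] ?; rewrite /=; ring.
Qed.

Lemma GamS a t p : Gam a t p = expi a *:
  mx2 (zpt t p) ('i * (cos t)%:C) ('i * (cos t)%:C) (zptc t p).
Proof. by rewrite /Gam /sphere_pt -conjc_zpt. Qed.

Lemma det_mx2 (K : comNzRingType) (x w v y : K) : \det (mx2 x w v y) = x * y - w * v.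
Proof. by rewrite det2E !mxE. Qed.

Lemma det_sphere t p : zpt t p * zptc t p - ('i * (cos t)%:C) ^+ 2 = 1.
Proof.
by rewrite zpt_mul exprMn sqrCi mulN1r opprK -rmorphXn -rmorphD /= subrK.
Qed.

Lemma on_cover_Gam a t p : on_cover (Gam a t p) (expi a).
Proof.
have d : \det (Gam a t p) = expi a ^+ 2.
  by rewrite GamS detZ det_mx2 -expr2 det_sphere mulr1.
split=> //; split; last by rewrite d expf_neq0 ?expi_neq0.
rewrite GamS; apply/matrixP => i j; rewrite !mxE.
by case: (i == 0); case: (j == 0).
Qed.

Lemma invmx_Gam a t p : invmx (Gam a t p) = Gam_inv a t p.
Proof.
have [[_ d0] _] := on_cover_Gam a t p.
have u : Gam a t p \in unitmx by rewrite unitmxE unitfE.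
suff e : Gam_inv a t p *m Gam a t p = 1%:M.
  by rewrite -[LHS]mul1mx -e -mulmxA mulmxV// mulmx1.
rewrite GamS /Gam_inv -scalemxAl -scalemxAr scalerA -expiD addNr expi0 scale1r.
have := det_sphere t p; move: (zpt t p) (zptc t p) ('i * _) => x y w e.
apply/matrixP => i j; rewrite !mxE !big_ord_recl !big_ord0 !mxE /=.
by case: i => -[|[|//]] ?; case: j => -[|[|//]] ?; rewrite /= -?e; ring.
Qed.

Lemma sandwich_Gam a t p (A B C : R[i]) :
  Gam a t p *m mx2 A B B C *m Gam a t p = expi a ^ 2 *:
    ((zpt t p * A + 2 * ('i * (cos t)%:C) * B + zptc t p * C) *:
      mx2 (zpt t p) ('i * (cos t)%:C) ('i * (cos t)%:C) (zptc t p)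
     - mx2 C (- B) (- B) A).
Proof.
rewrite GamS -!scalemxAl -scalemxAr scalerA -expr2 sandwich det_sphere scale1r.
by [].
Qed.

Lemma scale_sandwich (n : nat) (c : R[i]) (X A : 'M[R[i]]_n) :
  X *m (c *: A) *m X = c *: (X *m A *m X).
Proof. by rewrite -scalemxAr -scalemxAl. Qed.

(** * Traces of products of a sphere point with the matrix harmonics *)

Section Traces.
Variables (t p : R) (t0 : sin t != 0).
Local Notation z := (zpt t p).
Local Notation zc := (zptc t p).
Local Notation c := ((cos t)%:C).
Local Notation Y l m := (sharm l m t p).

(** In the contiguity expansion of tr(X M_l) both the terms of degree l + 1 and those of degree l -
    1 cancel. *)
Lemma trace_M (l : nat) (m : int) : (`|m| <= l)%N ->
  z * (((l%:Z + m) * (l%:Z - m + 1))%:~R * Y l (m - 1))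
  + 2 * ('i * c) * (- 'i * m%:~R * Y l m) + zc * Y l (m + 1) = 0.
Proof.
move=> ml; have l0 : 0 <= l%:Z by [].
have n0 : (2 * l%:Z + 1)%:~R != 0 :> R[i] by rewrite intr_eq0; lia.
have d := sharm_down (m + 1) p t0 l0; rewrite addrK in d.
(* At m = - l the index m - 1 is outside the range of [sharm_up], but the factor l + m is 0. *)
have h : (l%:Z + m)%:~R * ((2 * l%:Z + 1)%:~R * (z * Y l (m - 1)))
   = (l%:Z + m)%:~R * (Y (l%:Z - 1) m - Y (l%:Z + 1) m).
  have [->|lm] := eqVneq (l%:Z + m) 0; first by rewrite !mul0r.
  by rewrite sharm_up ?subrK//; lia.
have lm : - l%:Z <= m by lia.
have e := sharm_cos t p l0 lm.
apply: (mulfI n0); rewrite mulr0.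
transitivity ((l%:Z - m + 1)%:~R *
    ((l%:Z + m)%:~R * ((2 * l%:Z + 1)%:~R * (z * Y l (m - 1))))
  - 2 * 'i ^+ 2 * m%:~R * ((2 * l%:Z + 1)%:~R * (c * Y l m))
  + (2 * l%:Z + 1)%:~R * (zc * Y l (m + 1))).
  by move: (Y _ _) (Y _ _) (Y _ _) => x1 x2 x3; ring.
rewrite h e d sqrCi; move: (Y _ _) (Y _ _) => x1 x2; ring.
Qed.

(** Here only the terms of degree l - 1 cancel. The cases m = - l and m = - l - 1, beyond the
    contiguity relations, have zero coefficients. *)
Lemma trace_T (l m : int) : 0 <= l -> - l - 1 <= m ->
  z * (((l + m) * (l + m + 1))%:~R * Y l (m - 1))
  + 2 * ('i * c) * ('i * (l + m + 1)%:~R * Y l m) + zc * (- Y l (m + 1))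
  = - (2 * (l + 1))%:~R * Y (l + 1) m.
Proof.
move=> l0 lm.
have n0 : (2 * l + 1)%:~R != 0 :> R[i] by rewrite intr_eq0; lia.
have d := sharm_down (m + 1) p t0 l0; rewrite addrK in d.
have h : ((l + m) * (l + m + 1))%:~R * ((2 * l + 1)%:~R * (z * Y l (m - 1)))
   = ((l + m) * (l + m + 1))%:~R * (Y (l - 1) m - Y (l + 1) m).
  have [->|lm1] := eqVneq (l + m) 0; first by rewrite !mul0r.
  have [->|lm2] := eqVneq (l + m + 1) 0; first by rewrite mulr0 !mul0r.
  by rewrite sharm_up ?subrK//; lia.
have e : (l + m + 1)%:~R * ((2 * l + 1)%:~R * (c * Y l m)) = (l + m + 1)%:~R *
    ((l - m + 1)%:~R * Y (l + 1) m + (l + m)%:~R * Y (l - 1) m).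
  have [->|lm2] := eqVneq (l + m + 1) 0; first by rewrite !mul0r.
  by rewrite sharm_cos//; lia.
apply: (mulfI n0).
transitivity (((l + m) * (l + m + 1))%:~R * ((2 * l + 1)%:~R * (z * Y l (m - 1)))
  + 2 * 'i ^+ 2 * ((l + m + 1)%:~R * ((2 * l + 1)%:~R * (c * Y l m)))
  - (2 * l + 1)%:~R * (zc * Y l (m + 1))).
  by move: (Y _ _) (Y _ _) (Y _ _) => x1 x2 x3; ring.
rewrite h e d sqrCi; move: (Y _ _) (Y _ _) => x1 x2; ring.
Qed.

(** Here only the terms of degree l + 1 cancel; the bound on m keeps every index within the
    contiguity relations. *)
Lemma trace_B (l m : int) : 0 <= l -> `|m| < l ->
  z * (((l - m) * (l - m + 1))%:~R * Y l (m - 1))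
  + 2 * ('i * c) * (- 'i * (l - m)%:~R * Y l m) + zc * (- Y l (m + 1))
  = (2 * l)%:~R * Y (l - 1) m.
Proof.
move=> l0 lm.
have n0 : (2 * l + 1)%:~R != 0 :> R[i] by rewrite intr_eq0; lia.
have d := sharm_down (m + 1) p t0 l0; rewrite addrK in d.
have lm1 : - l <= m - 1 by lia.
have lm2 : - l <= m by lia.
have h := sharm_up p t0 l0 lm1; rewrite subrK in h.
have e := sharm_cos t p l0 lm2.
apply: (mulfI n0).
transitivity (((l - m) * (l - m + 1))%:~R * ((2 * l + 1)%:~R * (z * Y l (m - 1)))
  - 2 * 'i ^+ 2 * (l - m)%:~R * ((2 * l + 1)%:~R * (c * Y l m))
  - (2 * l + 1)%:~R * (zc * Y l (m + 1))).
  by move: (Y _ _) (Y _ _) (Y _ _) => x1 x2 x3; ring.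
rewrite h e d sqrCi; move: (Y _ _) (Y _ _) => x1 x2; ring.
Qed.

End Traces.


(** * Products with polynomial g and f *)

Lemma null_fun_bigsum (I : finType) (H : I -> R -> R -> R -> R[i]) :
  (forall i, null_fun (H i)) -> null_fun (fun a t p => \sum_i H i a t p).
Proof. by move=> nH; apply: null_fun_sum => i _; exact: nH. Qed.

Lemma mulmx_row_col (n : nat) (u : 'rV[R[i]]_n) (A : 'M[R[i]]_n) (v : 'cV[R[i]]_n) :
  (u *m A *m v) 0 0 = \sum_i \sum_j u 0 i * A i j * v j 0.
Proof.
rewrite exchange_big mxE; apply: eq_bigr => j _.
by rewrite mxE mulr_suml.
Qed.

Lemma mulmx_scale2 (K : comNzRingType) (n : nat) (x : K) (u : 'rV[K]_n)
    (X A : 'M[K]_n) (v : 'cV[K]_n) :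
  (x *: (u *m X)) *m A *m (x *: (X *m v)) = (x * x) *: (u *m (X *m A *m X) *m v).
Proof. by rewrite -!scalemxAl -scalemxAr scalerA !mulmxA. Qed.

(** Reduces matrix harmonics to scalar ones: the factor [v] and the order [m'] depend on the entry
    but not on the point. *)
Lemma mx2_entry (I : Type) (Yf : I -> int -> R[i]) (x y w : R[i]) (m1 m2 m3 : int)
    (i j : 'I_2) : exists v m', forall z,
  mx2 (x * Yf z m1) (y * Yf z m2) (y * Yf z m2) (w * Yf z m3) i j = v * Yf z m'.
Proof.
case ei : (i == 0); case ej : (j == 0).
- by exists x, m1 => z; rewrite mxE ei ej.
- by exists y, m2 => z; rewrite mxE ei ej.
- by exists y, m2 => z; rewrite mxE ei ej.
- by exists w, m3 => z; rewrite mxE ei ej.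
Qed.

(** One l comes from the homogeneity of R^m_l and the other from its orthogonality. The alternative
    x = 0 serves the exceptional index in [null_C_plus]. *)
Lemma null_peval_RR q (k : int) (l : nat) (m : int) (x : R[i]) :
  x = 0 \/ 0 < k + 3 + 2 * l%:Z ->
  null_fun (fun a t p => peval q (Gam a t p) * (x * expi a ^ k * RR l m (Gam a t p))).
Proof.
move=> [->|kl].
  by apply: (null_fun_ext (null_fun0 R)) => a t p _; rewrite !mul0r mulr0.
have kl' : 0 < k + l%:Z + 3 + l%:Z by lia.
apply: (null_fun_ext (null_funZ x (null_peval_Gam q m kl'))) => a t p t0.
rewrite RR_Gam// expfzDr ?expi_neq0//.
by move: (peval _ _) (expi a ^ k) (expi a ^ l) (sharm _ _ _ _) => x1 x2 x3 x4; ring.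
Qed.

Lemma null_M_plus q (k m : int) (l : nat) (i j : 'I_2) : - (l%:Z + 1) <= k ->
  null_fun (fun a t p => peval q (Gam a t p) * NstarM k 1 l m (Gam a t p) (expi a) i j).
Proof.
move=> kl.
have [v [m' e]] := mx2_entry (fun Z m => RR l m Z) ((l%:Z + m) * (l%:Z - m + 1))%:~R
  (- 'i * m%:~R) 1 (m - 1) m (m + 1) i j.
have kl' : v = 0 \/ 0 < 2 * k + 1 + 3 + 2 * l%:Z by right; lia.
apply: (null_fun_ext (null_peval_RR q m' kl')) => a t p t0.
rewrite mxE /starM -[RR l (m + 1) _]mul1r e; congr (_ * _).
by rewrite mulrA [v * _]mulrC.
Qed.

Lemma null_C_plus q (k m : int) (l : nat) (i j : 'I_2) : (0 < l)%N ->
  - (l%:Z + 1) <= k ->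
  null_fun (fun a t p => peval q (Gam a t p) * starC k l m (Gam a t p) (expi a) i j).
Proof.
move=> l0 kl.
have [v [m' e]] := mx2_entry (fun Z m => RR l.+1 m Z)
  ((l.+1%:Z - m) * (l.+1%:Z - m + 1))%:~R
  (- 'i * (l.+1%:Z - m)%:~R) (-1) (m - 1) m (m + 1) i j.
have [v2 [m2 e2]] := mx2_entry (fun Z m => RR l.-1 m Z)
  ((l.-1%:Z + m) * (l.-1%:Z + m + 1))%:~R
  ('i * (l.-1%:Z + m + 1)%:~R) (-1) (m - 1) m (m + 1) i j.
pose x1 : R[i] := ((2 * k + 1) * l%:Z)%:~R * v.
pose x2 : R[i] := (2 * (k + l%:Z + 1) * (l%:Z + 1))%:~R * v2.
have h1 : x1 = 0 \/ 0 < 2 * k - 1 + 3 + 2 * l.+1%:Z by right; lia.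
(* At k = -(l + 1) the exponent condition fails with equality, but the coefficient contains the
   factor k + l + 1. *)
have h2 : x2 = 0 \/ 0 < 2 * k + 1 + 3 + 2 * l.-1%:Z.
  have [k0|k0] := eqVneq (k + l%:Z + 1) 0; last by right; lia.
  by left; rewrite /x2 k0 mulr0 mul0r mul0r.
apply: (null_fun_ext (null_funD (null_peval_RR q m' h1) (null_peval_RR q m2 h2))) => a t p t0.
rewrite mxE [X in _ * (X + _)]mxE [X in _ * (_ + X)]mxE.
rewrite /starB /starT -[- RR l.+1 _ _]mulN1r -[- RR l.-1 _ _]mulN1r e e2 /x1 /x2.
move: (peval _ _) (RR _ _ _) (RR _ _ _) (_ ^ (2 * k - 1)) (_ ^ (2 * k + 1)) => y1 y2 y3 y4 y5.
by ring.
Qed.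

(** By linearity it suffices to take one generator and one matrix entry, against which g and f
    contribute the polynomial p_i q_j. *)
Lemma null_plus g F f : @U'res_plus R g -> Cspan (@Wgens_plus R) F -> @Ures_plus R f ->
  null_fun (fun a t p => (g (Gam a t p) *m F (Gam a t p) (expi a) *m f (Gam a t p)) 0 0).
Proof.
move=> /choice[P gP] [n [c [G [SG FE]]]] /choice[Q fQ].
have N i j (k : 'I_n) : null_fun (fun a t p =>
    c k * (peval (P i * Q j) (Gam a t p) * G k (Gam a t p) (expi a) i j)).
  apply: null_funZ.
  have [k' [l [m [_ kl [->|[l0 ->]]]]]] := SG k; first exact: null_M_plus.
  exact: null_C_plus.
have N3 := null_fun_bigsum (fun i => null_fun_bigsum (fun j => null_fun_bigsum (N i j))).
apply: (null_fun_ext N3) => a t p t0.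
have cov := on_cover_Gam a t p; have [Zs _] := cov.
rewrite mulmx_row_col; apply: eq_bigr => i _; apply: eq_bigr => j _.
have -> : F (Gam a t p) (expi a) i j = \sum_k c k * G k (Gam a t p) (expi a) i j.
  by rewrite FE// summxE; apply: eq_bigr => k _; rewrite mxE.
rewrite gP// fQ// mulr_sumr mulr_suml. apply: eq_bigr => k _.
rewrite pevalM; move: (peval _ _) (peval _ _) (G _ _ _ _ _) => x y z; ring.
Qed.


(** * Products with g and f regular at infinity *)

Lemma null_sharm_inv q (K n m : int) (x : R[i]) : 0 <= n -> x = 0 \/ K + 3 < n ->
  null_fun (fun a t p => expi a ^ K * peval q (Gam_inv a t p) * (x * sharm n m t p)).
Proof.
case: n => // n _ [->|kl].
  by apply: (null_fun_ext (null_fun0 R)) => a t p _; rewrite !mul0r mulr0.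
apply: (null_fun_ext (null_funZ x (null_peval_Gam_inv q m kl))) => a t p t0.
by rewrite mulrCA.
Qed.

Lemma starM_Gam (l : nat) (m : int) a t p : sin t != 0 ->
  starM l m (Gam a t p) = expi a ^ l *:
  mx2 (((l%:Z + m) * (l%:Z - m + 1))%:~R * sharm l (m - 1) t p)
    (- 'i * m%:~R * sharm l m t p) (- 'i * m%:~R * sharm l m t p)
    (sharm l (m + 1) t p).
Proof.
move=> t0; rewrite /starM !RR_Gam//; apply/matrixP => i j; rewrite !mxE.
by case: (i == 0); case: (j == 0); rewrite // mulrCA.
Qed.

Lemma starB_Gam (l : nat) (m : int) a t p : sin t != 0 ->
  starB l m (Gam a t p) = expi a ^ l *:
  mx2 (((l%:Z - m) * (l%:Z - m + 1))%:~R * sharm l (m - 1) t p)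
    (- 'i * (l%:Z - m)%:~R * sharm l m t p)
    (- 'i * (l%:Z - m)%:~R * sharm l m t p)
    (- sharm l (m + 1) t p).
Proof.
move=> t0; rewrite /starB !RR_Gam//; apply/matrixP => i j; rewrite !mxE.
by case: (i == 0); case: (j == 0); rewrite -?mulrN // mulrCA.
Qed.

Lemma starT_Gam (l : nat) (m : int) a t p : sin t != 0 ->
  starT l m (Gam a t p) = expi a ^ l *:
  mx2 (((l%:Z + m) * (l%:Z + m + 1))%:~R * sharm l (m - 1) t p)
    ('i * (l%:Z + m + 1)%:~R * sharm l m t p)
    ('i * (l%:Z + m + 1)%:~R * sharm l m t p)
    (- sharm l (m + 1) t p).
Proof.
move=> t0; rewrite /starT !RR_Gam//; apply/matrixP => i j; rewrite !mxE.
by case: (i == 0); case: (j == 0); rewrite -?mulrN // mulrCA.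
Qed.

(** The factor zeta^(-4) collects N(Z)^(-1) from each of g and f. As tr(X M_l) = 0, the product X
    M_l X is just - adj M_l. *)
Lemma null_M_minus q (k m : int) (l : nat) (i j : 'I_2) : (`|m| <= l)%N -> k <= -1 ->
  null_fun (fun a t p => expi a ^ (-4) * peval q (Gam_inv a t p) *
    (Gam a t p *m NstarM k (-1) l m (Gam a t p) (expi a) *m Gam a t p) i j).
Proof.
move=> ml k1.
have [v [m' e]] := mx2_entry (fun tp m => sharm l m tp.1 tp.2) (-1)
  ('i * - m%:~R) (- ((l%:Z + m) * (l%:Z - m + 1))%:~R) (m + 1) m (m - 1) i j.
(* The exponents come from zeta^(-4), N(Z)^(k - 1/2), the degree of M_l and the two factors Z. *)
have kl : v = 0 \/ (-4 + 2 * k - 1 + l%:Z + 2) + 3 < l%:Z by right; lia.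
have l0 : 0 <= l%:Z by [].
apply: (null_fun_ext (null_sharm_inv q m' l0 kl)) => a t p t0.
rewrite /NstarM starM_Gam// scalerA scale_sandwich sandwich_Gam.
rewrite trace_M// scale0r sub0r scalerA.
rewrite mxE (_ : (- mx2 _ _ _ _) i j = v * sharm l m' t p); last first.
  rewrite -(e (t, p)) !mxE; case: (i == 0); case: (j == 0); ring.
rewrite !expfzDr ?expi_neq0//.
move: (expi a ^ _) (expi a ^ _) (expi a ^ _) (expi a ^ _) (expi a ^ _) (peval _ _) (sharm _ _ _ _).
by move=> x1 x2 x3 x4 x5 x6 x7; ring.
Qed.

(** [x] and [y] are the components in R_(l+1) and R_(l-1); the vanishing of [y] at k = -1 reflects
    the relative coefficients of B and T in C_(k,l). *)
Lemma C_minus_entries (k m : int) (l : nat) (i j : 'I_2) : (0 < l)%N -> (`|m| <= l)%N ->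
  exists x y m', (k = -1 -> y = 0) /\ forall a t p, sin t != 0 ->
  (Gam a t p *m starC k l m (Gam a t p) (expi a) *m Gam a t p) i j
  = expi a ^ (2 * k + l%:Z + 2) *
    (x * sharm (l%:Z + 1) m' t p + y * sharm (l%:Z - 1) m' t p).
Proof.
move=> l0 ml.
pose c1 : R[i] := ((2 * k + 1) * l%:Z)%:~R.
pose c2 : R[i] := (2 * (k + l%:Z + 1) * (l%:Z + 1))%:~R.
have n0 : (2 * l%:Z + 1)%:~R != 0 :> R[i] by rewrite intr_eq0; lia.
(* By [trace_B] and [trace_T] the traces add up to (2 l + 1) g R_l; the factor 2 l + 1 is kept apart
   for the contiguity relations. *)
pose g : R[i] := ((2 * (l%:Z + 1))%:~R * c1 - (2 * l%:Z)%:~R * c2) / (2 * l%:Z + 1)%:~R.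
have gE : (2 * (l%:Z + 1))%:~R * c1 - (2 * l%:Z)%:~R * c2 = g * (2 * l%:Z + 1)%:~R.
  by rewrite /g divfK.
have g0 : k = -1 -> g + c2 = 0.
  move=> k1; apply: (mulIf n0); rewrite mul0r mulrDl -gE /c1 /c2 k1; ring.
have lS : l.+1%:Z = l%:Z + 1 by lia.
have lP : l.-1%:Z = l%:Z - 1 by lia.
(* Cayley-Hamilton applied to both summands: the multiples of X are merged through [g], and the
   adjugates are subtracted. *)
have CE a t p : sin t != 0 ->
  Gam a t p *m starC k l m (Gam a t p) (expi a) *m Gam a t p
  = expi a ^ (2 * k + l%:Z + 2) *:
  let z := zpt t p in let w := 'i * (cos t)%:C in let y := zptc t p in
  let Yn n j := sharm n j t p in
  (g *: ((2 * l%:Z + 1)%:~R *: mx2 (z * Yn l m) (w * Yn l m) (w * Yn l m) (y * Yn l m))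
   - mx2 (- c1 * Yn (l%:Z + 1) (m + 1) - c2 * Yn (l%:Z - 1) (m + 1))
     ('i * ((l%:Z - m + 1)%:~R * c1 * Yn (l%:Z + 1) m - (l%:Z + m)%:~R * c2 * Yn (l%:Z - 1) m))
     ('i * ((l%:Z - m + 1)%:~R * c1 * Yn (l%:Z + 1) m - (l%:Z + m)%:~R * c2 * Yn (l%:Z - 1) m))
     (((l%:Z - m + 1) * (l%:Z - m + 2))%:~R * c1 * Yn (l%:Z + 1) (m - 1) +
      ((l%:Z + m - 1) * (l%:Z + m))%:~R * c2 * Yn (l%:Z - 1) (m - 1))).
  move=> t0; rewrite /starC starB_Gam// starT_Gam// !scalerA -/c1 -/c2 lS lP.
  rewrite mulmxDr mulmxDl !scale_sandwich !sandwich_Gam.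
  have l1 : 0 <= l%:Z + 1 by lia.
  have ml1 : `|m| < l%:Z + 1 by lia.
  have l2 : 0 <= l%:Z - 1 by lia.
  have ml2 : - (l%:Z - 1) - 1 <= m by lia.
  rewrite trace_B// trace_T// addrK subrK -gE.
  have E1 : expi a ^ (2 * k - 1) * expi a ^ (l%:Z + 1) = expi a ^ (2 * k + l%:Z).
    by rewrite -expfzDr ?expi_neq0//; congr (_ ^ _); lia.
  have E2 : expi a ^ (2 * k + 1) * expi a ^ (l%:Z - 1) = expi a ^ (2 * k + l%:Z).
    by rewrite -expfzDr ?expi_neq0//; congr (_ ^ _); lia.
  rewrite -[c1 * _ * _]mulrA -[c2 * _ * _]mulrA E1 E2 [expi a ^ (_ + 2)]expfzDr ?expi_neq0//.
  move: (expi a ^ _) (expi a ^ _) => x1 x2.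
  move: (c1) (c2) (zpt t p) (zptc t p) (cos t)%:C (sharm _ _ _ _) (sharm _ _ _ _) (sharm _ _ _ _)
    (sharm _ _ _ _) (sharm _ _ _ _) (sharm _ _ _ _) (sharm _ _ _ _).
  move=> d1 d2 y1 y2 y3 y4 y5 y6 y7 y8 y9 y10.
  by apply/matrixP => u v; rewrite !mxE; case: (u == 0); case: (v == 0); ring.
have lz : 0 <= l%:Z by [].
have lm : - l%:Z <= m by lia.
(* The entries of X are z, i t and conj(z), so each case uses the matching contiguity relation to
   expand (2 l + 1) R_l X. The component in R_(l-1) is always a multiple of g + c2. *)
case ei : (i == 0); case ej : (j == 0).
2,3: exists ('i * (l%:Z - m + 1)%:~R * (g - c1)), ('i * (l%:Z + m)%:~R * (g + c2)), m;
  split=> [/g0 ->|a t p t0]; first by rewrite mulr0.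
2,3: rewrite CE// !mxE ei ej -[_ * _ * sharm l m t p]mulrA [_ * ('i * _)]mulrCA;
  rewrite sharm_cos//; move: (sharm _ _ _ _) (sharm _ _ _ _) => y1 y2; ring.
- exists (c1 - g), (g + c2), (m + 1); split=> // a t p t0.
  rewrite CE// !mxE ei ej sharm_up//.
  by move: (sharm _ _ _ _) (sharm _ _ _ _) => y1 y2; ring.
- exists (((l%:Z - m + 1) * (l%:Z - m + 2))%:~R * (g - c1)),
    (- ((l%:Z + m - 1) * (l%:Z + m))%:~R * (g + c2)), (m - 1).
  split=> [/g0 ->|a t p t0]; first by rewrite mulr0.
  rewrite CE// !mxE ei ej sharm_down//.
  by move: (sharm _ _ _ _) (sharm _ _ _ _) => y1 y2; ring.
Qed.

Lemma null_C_minus q (k m : int) (l : nat) (i j : 'I_2) : (0 < l)%N -> (`|m| <= l)%N ->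
  k <= -1 ->
  null_fun (fun a t p => expi a ^ (-4) * peval q (Gam_inv a t p) *
    (Gam a t p *m starC k l m (Gam a t p) (expi a) *m Gam a t p) i j).
Proof.
move=> l0 ml k1; have [x [y [m' [y0 e]]]] := C_minus_entries k i j l0 ml.
pose K := -4 + (2 * k + l%:Z + 2).
have hx : x = 0 \/ K + 3 < l%:Z + 1 by right; rewrite /K; lia.
(* Here K + 3 = 2 k + l + 1, which is less than l - 1 unless k = -1, where the component
   vanishes. *)
have hy : y = 0 \/ K + 3 < l%:Z - 1.
  have [/y0 ->|kn] := eqVneq k (-1); first by left.
  by right; rewrite /K; lia.
have l1 : 0 <= l%:Z + 1 by lia.
have l2 : 0 <= l%:Z - 1 by lia.
apply: (null_fun_ext (null_funD (null_sharm_inv q m' l1 hx) (null_sharm_inv q m' l2 hy))).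
move=> a t p t0; rewrite e// /K [expi a ^ (-4 + _)]expfzDr ?expi_neq0//.
move: (expi a ^ _) (expi a ^ _) (peval _ _) (sharm _ _ _ _) (sharm _ _ _ _) => x1 x2 x3 x4 x5.
by ring.
Qed.

Lemma null_minus g F f : @U'res_minus R g -> Cspan (@Wgens_minus R) F -> @Ures_minus R f ->
  null_fun (fun a t p => (g (Gam a t p) *m F (Gam a t p) (expi a) *m f (Gam a t p)) 0 0).
Proof.
move=> [_ /choice[P gP]] [n [c [G [SG FE]]]] [_ /choice[Q fQ]].
have N i j (k : 'I_n) : null_fun (fun a t p =>
    c k * (expi a ^ (-4) * peval (P i * Q j) (Gam_inv a t p) *
      (Gam a t p *m G k (Gam a t p) (expi a) *m Gam a t p) i j)).
  apply: null_funZ.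
  have [k' [l [m [ml kl [->|[l0 ->]]]]]] := SG k; first exact: null_M_minus.
  exact: null_C_minus.
have N3 := null_fun_bigsum (fun i => null_fun_bigsum (fun j => null_fun_bigsum (N i j))).
apply: (null_fun_ext N3) => a t p t0.
have cov := on_cover_Gam a t p; have [[sZ dZ] s2] := cov.
have u : Gam a t p \in unitmx by rewrite unitmxE unitfE.
have iZ : sym_inv (invmx (Gam a t p)).
  by split; [rewrite trmx_inv sZ|rewrite det_inv invr_eq0].
(* [gr] and [fc] are the values at Z^(-1) of the polynomials that define membership in the minus
   spaces. Evaluating those conditions at Z^(-1) yields g = N^(-1) p(Z^(-1)) Z and f = N^(-1) Z
   q(Z^(-1)). *)
pose gr : 'rV[R[i]]_2 := \row_i peval (P i) (Gam_inv a t p).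
pose fc : 'cV[R[i]]_2 := \col_j peval (Q j) (Gam_inv a t p).
have gE : g (Gam a t p) = expi a ^ (-2) *: (gr *m Gam a t p).
  have -> : gr = \det (Gam a t p) *: (g (Gam a t p) *m invmx (Gam a t p)).
    apply/rowP => i; have h := gP i _ iZ; rewrite det_inv invrK invmxK in h.
    by rewrite mxE -invmx_Gam -h.
  rewrite -scalemxAl mulmxKV// scalerA -s2 -exprnN -[_ ^- 2]/((expi a ^+ 2)^-1).
  by rewrite mulVf ?scale1r// expf_neq0 ?expi_neq0.
have fE : f (Gam a t p) = expi a ^ (-2) *: (Gam a t p *m fc).
  have -> : fc = \det (Gam a t p) *: (invmx (Gam a t p) *m f (Gam a t p)).
    apply/colP => i; have h := fQ i _ iZ; rewrite det_inv invrK invmxK in h.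
    by rewrite mxE -invmx_Gam -h.
  rewrite -scalemxAr mulKVmx// scalerA -s2 -exprnN -[_ ^- 2]/((expi a ^+ 2)^-1).
  by rewrite mulVf ?scale1r// expf_neq0 ?expi_neq0.
have -> : g (Gam a t p) *m F (Gam a t p) (expi a) *m f (Gam a t p)
  = expi a ^ (-4) *: (gr *m (Gam a t p *m F (Gam a t p) (expi a) *m Gam a t p) *m fc).
  by rewrite gE fE mulmx_scale2 -expfzDr ?expi_neq0.
rewrite mxE mulmx_row_col mulr_sumr; apply: eq_bigr => i _.
rewrite mulr_sumr; apply: eq_bigr => j _.
have -> : (Gam a t p *m F (Gam a t p) (expi a) *m Gam a t p) i j
  = \sum_k c k * (Gam a t p *m G k (Gam a t p) (expi a) *m Gam a t p) i j.
  rewrite FE// mulmx_sumr mulmx_suml summxE; apply: eq_bigr => k _.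
  by rewrite scale_sandwich mxE.
rewrite !mxE mulr_sumr mulr_suml mulr_sumr; apply: eq_bigr => k _.
rewrite pevalM; move: (peval _ _) (peval _ _) (expi a ^ _) ((_ *m _) i j) => x y z w.
by ring.
Qed.

End Trilinear.

(** * Vanishing of both restrictions *)

Theorem lemma111 (R : realType) :
  (forall g F f,
     @U'res_plus R g -> Cspan (@Wgens_plus R) F -> @Ures_plus R f ->
     trilinear g F f = 0) /\
  (forall g F f,
     @U'res_minus R g -> Cspan (@Wgens_minus R) F -> @Ures_minus R f ->
     trilinear g F f = 0).
Proof.
split=> g F f gP FP fP; rewrite /trilinear Gam_integral_null ?mulr0//.
  exact: null_plus.
exact: null_minus.
Qed.
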